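(* The Lie algebra $\mathcal O$ has a presentation by generators $\mathcal W_0$, $\mathcal W_1$, $\lbrace\tilde{\mathcal G}_{k+1}\rbrace_{k\in\mathbb N}$ and the following relations: \begin{align*} &[\mathcal W_0,[\mathcal W_0,[\mathcal W_0,\mathcal W_1]]]=4[\mathcal W_0,\mathcal W_1],\\ &[\mathcal W_1,[\mathcal W_1,[\mathcal W_1,\mathcal W_0]]]=4[\mathcal W_1,\mathcal W_0],\\ &[\mathcal W_0,[\mathcal W_0,\mathcal W_1]]=[\mathcal W_0,\tilde{\mathcal G}_1],\\ &[[\mathcal W_0,\mathcal W_1],\mathcal W_1]=[\tilde{\mathcal G}_1,\mathcal W_1],\\ &[\mathcal W_0,[\mathcal W_0,[\mathcal W_1,\tilde{\mathcal G}_k]]]=4[\mathcal W_0,\tilde{\mathcal G}_{k+1}]\qquad (k\in\mathbb N^+),\\ &[[[\tilde{\mathcal G}_k,\mathcal W_0],\mathcal W_1],\mathcal W_1]=4[\tilde{\mathcal G}_{k+1},\mathcal W_1]\qquad (k\in\mathbb N^+),\\ &[\tilde{\mathcal G}_{k+1},\tilde{\mathcal G}_{\ell+1}]=0\qquad (k,\ell\in\mathbb N). \end{align*}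
   Context: $\mathbb F$ is a field of characteristic zero; all vector spaces and Lie algebras are over $\mathbb F$. $\mathbb N=\{0,1,2,\ldots\}$ and $\mathbb N^+=\{1,2,3,\ldots\}$. $\mathbb F[t,t^{-1}]$ is the algebra of Laurent polynomials. $L(\mathfrak{gl}_2)=\mathfrak{gl}_2\otimes\mathbb F[t,t^{-1}]$ is the loop algebra, with Lie bracket $[u\otimes\varphi,v\otimes\phi]=[u,v]\otimes\varphi\phi$; its elements are viewed as $2\times 2$ matrices with entries in $\mathbb F[t,t^{-1}]$, with bracket $[x,y]=xy-yx$. For $x=\begin{pmatrix} a(t)&b(t)\\ c(t)&d(t)\end{pmatrix}\in L(\mathfrak{gl}_2)$ define $\theta(x)=\begin{pmatrix} d(t^{-1})&c(t^{-1})\\ b(t^{-1})&a(t^{-1})\end{pmatrix}$ and $\varepsilon(x)=a(1)+d(1)\in\mathbb F$. Then $\theta$ is a Lie algebra automorphism of $L(\mathfrak{gl}_2)$ and $\varepsilon:L(\mathfrak{gl}_2)\to\mathbb F$ is a Lie algebra homomorphism ($\mathbb F$ abelian). Let $\mathcal L=\ker\varepsilon$, and let $\mathcal O$ be the Lie algebra of all elements of $\mathcal L$ fixed by $\theta$. In $\mathcal O$ define $$\mathcal W_0=\begin{pmatrix}0&1\\1&0\end{pmatrix},\qquad \mathcal W_1=\begin{pmatrix}0&t\\t^{-1}&0\end{pmatrix},\qquad \tilde{\mathcal G}_{k+1}=\Bigl(\tfrac{t+t^{-1}}{2}\Bigr)^k\begin{pmatrix}2t^{-1}-2&0\\0&2t-2\end{pmatrix}\quad(k\in\mathbb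 N).$$ ''$\mathcal O$ has a presentation by given generators and relations'' means: the Lie algebra over $\mathbb F$ defined abstractly by these generators and relations is isomorphic to $\mathcal O$ via the Lie algebra homomorphism sending each abstract generator to the element of $\mathcal O$ with the same name. *)

(* Defs.v *)
From HB Require Import structures.
From mathcomp Require Import all_boot all_algebra finmap generic_quotient boolp.
From mathcomp Require Import ring.
From mathcomp.multinomials Require Import monalg.

Set Implicit Arguments.
Unset Strict Implicit.
Unset Printing Implicit Defensive.

Import GRing.Theory.
Local Open Scope quotient_scope.
Local Open Scope ring_scope.

Declare Scope lie_term_scope.
Delimit Scope lie_term_scope with T.

Reserved Notation "[ 'lie' x , y ]" (format "[ 'lie'  x ,  y ]").

HB.mixin Record Lmodule_isLieAlgebra (F : fieldType) L of GRing.Lmodule F L := {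
  lie_bracket : L -> L -> L;
  lieDl : forall x y z, lie_bracket (x + y) z = lie_bracket x z + lie_bracket y z;
  lieDr : forall x y z, lie_bracket x (y + z) = lie_bracket x y + lie_bracket x z;
  lieZl : forall a x y, lie_bracket (a *: x) y = a *: lie_bracket x y;
  lieZr : forall a x y, lie_bracket x (a *: y) = a *: lie_bracket x y;
  liexx : forall x, lie_bracket x x = 0;
  lie_jacobi : forall x y z,
    lie_bracket x (lie_bracket y z) + lie_bracket y (lie_bracket z x)
      + lie_bracket z (lie_bracket x y) = 0
}.

#[short(type="lieAlgType")]
HB.structure Definition LieAlgebra (F : fieldType) :=
  { L of GRing.Lmodule F L & Lmodule_isLieAlgebra F L }.

Notation "[ 'lie' x , y ]" := (lie_bracket x y) : ring_scope.

(** * The Lie algebra presented by generators [X] and relations [r]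

    It is the quotient of the formal Lie expressions over [X] by the smallest
    congruence that contains the Lie algebra axioms and the relations [r]. *)

Inductive lie_term (F : fieldType) (X : Type) : Type :=
| LieGen of X
| LieZero
| LieAdd of lie_term F X & lie_term F X
| LieScale of F & lie_term F X
| LieBracket of lie_term F X & lie_term F X.
Arguments LieGen {F X} _.
Arguments LieZero {F X}.

Bind Scope lie_term_scope with lie_term.
Notation "0" := LieZero : lie_term_scope.
Notation "s + t" := (LieAdd s t) : lie_term_scope.
Notation "a *: t" := (LieScale a%R t) : lie_term_scope.
Notation "[ 'lie' s , t ]" := (LieBracket s t) : lie_term_scope.

Section Congruence.
Context (F : fieldType) (X : Type).
Variable r : lie_term F X -> lie_term F X -> Prop.
Implicit Types (a b : F) (s t u : lie_term F X).
Local Open Scope lie_term_scope.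

Inductive lie_cong : lie_term F X -> lie_term F X -> Prop :=
| lc_rel s t : r s t -> lie_cong s t
| lc_refl s : lie_cong s s
| lc_sym s t : lie_cong s t -> lie_cong t s
| lc_trans s t u : lie_cong s t -> lie_cong t u -> lie_cong s u
| lc_add s s' t t' : lie_cong s s' -> lie_cong t t' ->
    lie_cong (s + t) (s' + t')
| lc_scale a s s' : lie_cong s s' -> lie_cong (a *: s) (a *: s')
| lc_bracket s s' t t' : lie_cong s s' -> lie_cong t t' ->
    lie_cong [lie s, t] [lie s', t']
(* the opposite of [s] is [-1 *: s] *)
| lc_addA s t u : lie_cong (s + (t + u)) (s + t + u)
| lc_addC s t : lie_cong (s + t) (t + s)
| lc_add0 s : lie_cong (0 + s) s
| lc_scale0 s : lie_cong (0 *: s) 0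
| lc_scale1 s : lie_cong (1 *: s) s
| lc_scaleA a b s : lie_cong (a *: (b *: s)) ((a * b) *: s)
| lc_scaleDr a s t : lie_cong (a *: (s + t)) (a *: s + a *: t)
| lc_scaleDl a b s : lie_cong ((a + b) *: s) (a *: s + b *: s)
| lc_bracketDl s t u : lie_cong [lie s + t, u] ([lie s, u] + [lie t, u])
| lc_bracketDr s t u : lie_cong [lie s, t + u] ([lie s, t] + [lie s, u])
| lc_bracketZl a s t : lie_cong [lie a *: s, t] (a *: [lie s, t])
| lc_bracketZr a s t : lie_cong [lie s, a *: t] (a *: [lie s, t])
| lc_bracketxx s : lie_cong [lie s, s] 0
| lc_jacobi s t u :
    lie_cong ([lie s, [lie t, u]] + [lie t, [lie u, s]] + [lie u, [lie s, t]]) 0.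

End Congruence.

Section Presentation.
Context (F : fieldType) (X : Type).
Variable r : lie_term F X -> lie_term F X -> Prop.
Local Notation term := {classic (lie_term F X)}.

Definition lie_congb (s t : term) : bool := `[< lie_cong r s t >].

Lemma lie_congb_refl : reflexive lie_congb.
Proof. by move=> s; apply/asboolP/lc_refl. Qed.

Lemma lie_congb_sym : symmetric lie_congb.
Proof. by move=> s t; apply/asboolP/asboolP => /lc_sym. Qed.

Lemma lie_congb_trans : transitive lie_congb.
Proof.
by move=> t s u /asboolP st /asboolP tu; apply/asboolP; apply: lc_trans st tu.
Qed.

Canonical lie_congb_equiv :=
  EquivRel lie_congb lie_congb_refl lie_congb_sym lie_congb_trans.

Definition lie_pres := {eq_quot lie_congb}.
HB.instance Definition _ := Choice.on lie_pres.
HB.instance Definition _ := EqQuotient.on lie_pres.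

Definition lie_class (t : lie_term F X) : lie_pres := \pi_lie_pres (t : term).

Lemma lie_classP s t : lie_class s = lie_class t <-> lie_cong r s t.
Proof.
split; first by move=> /eqquotP /asboolP.
by move=> st; apply/eqquotP/asboolP.
Qed.

Lemma lie_class_repr (x : lie_pres) : lie_class (repr x) = x.
Proof. exact: reprK. Qed.

Lemma repr_lie_class t : lie_cong r (repr (lie_class t)) t.
Proof. by apply/lie_classP; rewrite lie_class_repr. Qed.

Definition lie_gen (x : X) : lie_pres := lie_class (LieGen x).

Definition pres_zero : lie_pres := lie_class 0%T.
Definition pres_add (x y : lie_pres) : lie_pres :=
  lie_class (LieAdd (repr x) (repr y)).
Definition pres_scale (a : F) (x : lie_pres) : lie_pres :=
  lie_class (LieScale a (repr x)).
Definition pres_bracket (x y : lie_pres) : lie_pres :=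
  lie_class (LieBracket (repr x) (repr y)).

Lemma pres_addE s t :
  pres_add (lie_class s) (lie_class t) = lie_class (LieAdd s t).
Proof. by apply/lie_classP/lc_add; apply: repr_lie_class. Qed.

Lemma pres_scaleE a s :
  pres_scale a (lie_class s) = lie_class (LieScale a s).
Proof. by apply/lie_classP/lc_scale; apply: repr_lie_class. Qed.

Lemma pres_bracketE s t :
  pres_bracket (lie_class s) (lie_class t) = lie_class (LieBracket s t).
Proof. by apply/lie_classP/lc_bracket; apply: repr_lie_class. Qed.

Let presE := (pres_addE, pres_scaleE, pres_bracketE).

Lemma lie_presW (P : lie_pres -> Prop) :
  (forall s, P (lie_class s)) -> forall x, P x.
Proof. by move=> PC x; rewrite -(lie_class_repr x); apply: PC. Qed.

Lemma pres_addA : associative pres_add.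
Proof.
do 3!elim/lie_presW=> ?; rewrite !presE; exact/lie_classP/lc_addA.
Qed.

Lemma pres_addC : commutative pres_add.
Proof. do 2!elim/lie_presW=> ?; rewrite !presE; exact/lie_classP/lc_addC. Qed.

Lemma pres_add0 : left_id pres_zero pres_add.
Proof. elim/lie_presW=> ?; rewrite !presE; exact/lie_classP/lc_add0. Qed.

Lemma pres_addN : left_inverse pres_zero (pres_scale (-1)) pres_add.
Proof.
elim/lie_presW=> s; rewrite !presE; apply/lie_classP.
apply: lc_trans (lc_scale0 r s); rewrite -(addNr 1).
apply: lc_trans (lc_sym (lc_scaleDl r _ _ _)).
exact: lc_add (lc_refl _ _) (lc_sym (lc_scale1 _ _)).
Qed.

HB.instance Definition _ := GRing.isZmodule.Build lie_pres
  pres_addA pres_addC pres_add0 pres_addN.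

Lemma pres_scaleA a b (x : lie_pres) :
  pres_scale a (pres_scale b x) = pres_scale (a * b) x.
Proof. elim/lie_presW: x=> ?; rewrite !presE; exact/lie_classP/lc_scaleA. Qed.

Lemma pres_scale1 : left_id 1 pres_scale.
Proof. elim/lie_presW=> ?; rewrite !presE; exact/lie_classP/lc_scale1. Qed.

Lemma pres_scaleDr : right_distributive pres_scale +%R.
Proof.
move=> a; do 2!elim/lie_presW=> ?; rewrite /GRing.add /= !presE.
exact/lie_classP/lc_scaleDr.
Qed.

Lemma pres_scaleDl (x : lie_pres) : {morph pres_scale^~ x : a b / a + b}.
Proof.
move=> a b; elim/lie_presW: x=> ?; rewrite [in RHS]/GRing.add /= !presE.
exact/lie_classP/lc_scaleDl.
Qed.

HB.instance Definition _ := GRing.Zmodule_isLmodule.Build F lie_pres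
  pres_scaleA pres_scale1 pres_scaleDr pres_scaleDl.

Lemma lie_class0 : lie_class 0%T = 0.
Proof. by []. Qed.

Lemma lie_classD s t : lie_class (s + t)%T = lie_class s + lie_class t.
Proof. by rewrite [RHS]pres_addE. Qed.

Lemma lie_classZ a s : lie_class (a *: s)%T = a *: lie_class s.
Proof. by rewrite [RHS]pres_scaleE. Qed.

Lemma pres_bracketDl (x y z : lie_pres) :
  pres_bracket (x + y) z = pres_bracket x z + pres_bracket y z.
Proof.
elim/lie_presW: x=> x; elim/lie_presW: y=> y; elim/lie_presW: z=> z.
rewrite -lie_classD !presE -lie_classD; exact/lie_classP/lc_bracketDl.
Qed.

Lemma pres_bracketDr (x y z : lie_pres) :
  pres_bracket x (y + z) = pres_bracket x y + pres_bracket x z.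
Proof.
elim/lie_presW: x=> x; elim/lie_presW: y=> y; elim/lie_presW: z=> z.
rewrite -lie_classD !presE -lie_classD; exact/lie_classP/lc_bracketDr.
Qed.

Lemma pres_bracketZl a (x y : lie_pres) :
  pres_bracket (a *: x) y = a *: pres_bracket x y.
Proof.
elim/lie_presW: x=> x; elim/lie_presW: y=> y.
rewrite -lie_classZ !presE -lie_classZ; exact/lie_classP/lc_bracketZl.
Qed.

Lemma pres_bracketZr a (x y : lie_pres) :
  pres_bracket x (a *: y) = a *: pres_bracket x y.
Proof.
elim/lie_presW: x=> x; elim/lie_presW: y=> y.
rewrite -lie_classZ !presE -lie_classZ; exact/lie_classP/lc_bracketZr.
Qed.

Lemma pres_bracketxx (x : lie_pres) : pres_bracket x x = 0.
Proof.
elim/lie_presW: x=> x; rewrite presE -lie_class0; exact/lie_classP/lc_bracketxx.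
Qed.

Lemma pres_jacobi (x y z : lie_pres) :
  pres_bracket x (pres_bracket y z) + pres_bracket y (pres_bracket z x)
    + pres_bracket z (pres_bracket x y) = 0.
Proof.
elim/lie_presW: x=> x; elim/lie_presW: y=> y; elim/lie_presW: z=> z.
rewrite !presE -!lie_classD -lie_class0; exact/lie_classP/lc_jacobi.
Qed.

HB.instance Definition _ := Lmodule_isLieAlgebra.Build F lie_pres
  pres_bracketDl pres_bracketDr pres_bracketZl pres_bracketZr
  pres_bracketxx pres_jacobi.

Lemma lie_class_bracket s t :
  lie_class [lie s, t]%T = [lie lie_class s, lie_class t].
Proof. by rewrite [RHS]pres_bracketE. Qed.

End Presentation.

Section Universal.
Context (F : fieldType) (X : Type).
Variable r : lie_term F X -> lie_term F X -> Prop.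
Variables (L : lieAlgType F) (g : X -> L).

Fixpoint lie_eval (t : lie_term F X) : L :=
  match t with
  | LieGen x => g x
  | LieZero => 0
  | LieAdd s t => lie_eval s + lie_eval t
  | LieScale a t => a *: lie_eval t
  | LieBracket s t => [lie lie_eval s, lie_eval t]
  end.

Hypothesis g_rel : forall s t, r s t -> lie_eval s = lie_eval t.

Lemma lie_eval_cong s t : lie_cong r s t -> lie_eval s = lie_eval t.
Proof.
elim=> {s t} //=; try by move=> *; congruence.
- by move=> *; rewrite addrA.
- by move=> *; rewrite addrC.
- by move=> *; rewrite add0r.
- by move=> *; rewrite scale0r.
- by move=> *; rewrite scale1r.
- by move=> *; rewrite scalerA.
- by move=> *; rewrite scalerDr.
- by move=> *; rewrite scalerDl.
- by move=> *; rewrite lieDl.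
- by move=> *; rewrite lieDr.
- by move=> *; rewrite lieZl.
- by move=> *; rewrite lieZr.
- by move=> *; rewrite liexx.
- by move=> *; rewrite lie_jacobi.
Qed.

Lemma lie_pres_universal :
  exists phi : {linear lie_pres r -> L},
    [/\ {morph phi : x y / [lie x, y]},
        forall x, phi (lie_gen r x) = g x
      & forall psi : {linear lie_pres r -> L},
          {morph psi : x y / [lie x, y]} ->
          (forall x, psi (lie_gen r x) = g x) -> psi =1 phi].
Proof.
pose f (x : lie_pres r) := lie_eval (repr x).
have fE t : f (lie_class r t) = lie_eval t.
  exact: lie_eval_cong (repr_lie_class _ _).
have lin_f : linear f.
  move=> a; elim/lie_presW=> x; elim/lie_presW=> y.
  by rewrite -lie_classZ -lie_classD !fE.
pose f_lin := GRing.isLinear.Build F (lie_pres r) L *:%R f lin_f.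
pose phi : {linear lie_pres r -> L} := HB.pack f f_lin.
exists phi; split=> [|x|psi psiM psig].
- elim/lie_presW=> x; elim/lie_presW=> y.
  by rewrite -lie_class_bracket /= !fE.
- by rewrite /= fE.
elim/lie_presW; elim=> [x||s IHs t IHt|a t IHt|s IHs t IHt] /=.
- by rewrite fE /= -psig.
- by rewrite lie_class0 raddf0 -lie_class0 fE.
- by rewrite fE lie_classD linearD IHs IHt /= !fE.
- by rewrite fE lie_classZ linearZ IHt /= !fE.
by rewrite fE lie_class_bracket psiM IHs IHt /= !fE.
Qed.

End Universal.

(** * Laurent polynomials: finitely supported functions [int -> F] with the
    convolution product *)

Definition laurent (F : fieldType) : Type := {malg F[int]}.

Section Laurent.
Context (F : fieldType).
Implicit Types (c : F) (i j k : int).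

HB.instance Definition _ := GRing.Lmodule.copy (laurent F) {malg F[int]}.
Implicit Types (f g h : laurent F).

(* the monomial t^k *)
Definition tpow k : laurent F := << 1 *g k >>.

Lemma laurentE f : f = \sum_(k <- msupp f) f@_k *: tpow k.
Proof.
rewrite [LHS]monalgE; apply: eq_bigr => k _; apply/malgP=> j.
by rewrite mcoeffZ !mcoeffU mulrnAr mulr1.
Qed.

Lemma laurent_ind (P : laurent F -> Prop) :
  P 0 -> (forall f g, P f -> P g -> P (f + g)) ->
  (forall c k, P (c *: tpow k)) -> forall f, P f.
Proof. by move=> P0 PD PM f; rewrite (laurentE f); elim/big_ind: _. Qed.

Section LinearExtension.
Context (V : lmodType F) (v : int -> V).

Definition lext f : V := \sum_(k <- msupp f) f@_k *: v k.

Lemma lextEw (d : {fset int}) f : fsubset (msupp f) d ->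
  lext f = \sum_(k <- d) f@_k *: v k.
Proof.
move=> le; rewrite [LHS](big_fset_incl _ le) => //= x xd /mcoeff_outdom ->.
by rewrite scale0r.
Qed.

Lemma lext_is_linear : linear lext.
Proof.
move=> c f g; pose d := fsetU (msupp f) (msupp g).
have le_cfg : fsubset (msupp (c *: f + g)) d.
  apply: fsubset_trans (msuppD_le _ _) _.
  exact: fsetSU (msuppZ_le _ _).
rewrite (lextEw le_cfg) (lextEw (fsubsetUl (msupp f) (msupp g))).
rewrite (lextEw (fsubsetUr (msupp f) (msupp g))) scaler_sumr -big_split /=.
by apply: eq_bigr => k _; rewrite mcoeffD mcoeffZ scalerDl scalerA.
Qed.

HB.instance Definition _ :=
  GRing.isLinear.Build F (laurent F) V *:%R lext lext_is_linear.

Lemma lext_tpow k : lext (tpow k) = v k.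
Proof. by rewrite (lextEw msuppU_le) big_seq_fset1 mcoeffUU scale1r. Qed.

End LinearExtension.

Definition laurent_mul f g : laurent F :=
  \sum_(i <- msupp f) \sum_(j <- msupp g) (f@_i * g@_j) *: tpow (i + j).

Lemma laurent_mulE f g :
  laurent_mul f g = lext (fun i => lext (fun j => tpow (i + j)) g) f.
Proof.
apply: eq_bigr => i _; rewrite scaler_sumr.
by apply: eq_bigr => j _; rewrite scalerA.
Qed.

Lemma laurent_mulC : commutative laurent_mul.
Proof.
move=> f g; rewrite /laurent_mul exchange_big /=.
apply: eq_bigr => i _; apply: eq_bigr => j _.
by rewrite mulrC [j + i]addrC.
Qed.

Lemma laurent_mulDl : left_distributive laurent_mul +%R.
Proof. by move=> f g h; rewrite !laurent_mulE raddfD. Qed.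

Lemma laurent_mulZl c f g : laurent_mul (c *: f) g = c *: laurent_mul f g.
Proof. by rewrite !laurent_mulE linearZ. Qed.

Lemma laurent_mulDr : right_distributive laurent_mul +%R.
Proof.
move=> f g h; rewrite laurent_mulC laurent_mulDl.
by rewrite -!(laurent_mulC f).
Qed.

Lemma laurent_mulZr c f g : laurent_mul f (c *: g) = c *: laurent_mul f g.
Proof. by rewrite !(laurent_mulC f) laurent_mulZl. Qed.

Lemma laurent_mul_tpow i j : laurent_mul (tpow i) (tpow j) = tpow (i + j).
Proof. by rewrite laurent_mulE !lext_tpow. Qed.

Lemma laurent_mul0l f : laurent_mul 0 f = 0.
Proof. by rewrite laurent_mulE raddf0. Qed.

Lemma laurent_mul0r f : laurent_mul f 0 = 0.
Proof. by rewrite laurent_mulC laurent_mul0l. Qed.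

Lemma laurent_mulA : associative laurent_mul.
Proof.
move=> f0; elim/laurent_ind: f0 => [|f g IHf IHg|c i] f1 f2.
- by rewrite !laurent_mul0l.
- by rewrite !laurent_mulDl IHf IHg.
elim/laurent_ind: f1 => [|f g IHf IHg|c1 j].
- by rewrite laurent_mul0r !laurent_mul0l laurent_mul0r.
- by rewrite laurent_mulDl !laurent_mulDr laurent_mulDl IHf IHg.
elim/laurent_ind: f2 => [|f g IHf IHg|c2 k].
- by rewrite !laurent_mul0r.
- by rewrite !laurent_mulDr IHf IHg.
rewrite !(laurent_mulZl, laurent_mulZr, laurent_mul_tpow) addrA.
by rewrite !scalerA [c * c1 * c2]mulrC mulrA.
Qed.

Lemma laurent_mul1 : left_id (tpow 0) laurent_mul.
Proof.
move=> f0; elim/laurent_ind: f0 => [|f g IHf IHg|c i].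
- by rewrite laurent_mul0r.
- by rewrite laurent_mulDr IHf IHg.
by rewrite laurent_mulZr laurent_mul_tpow add0r.
Qed.

Lemma laurent1_neq0 : tpow 0 != 0.
Proof.
by apply/eqP=> /malgP/(_ 0)/eqP; rewrite mcoeffUU mcoeff0 oner_eq0.
Qed.

HB.instance Definition _ := GRing.Zmodule_isComNzRing.Build (laurent F)
  laurent_mulA laurent_mulC laurent_mul1 laurent_mulDl laurent1_neq0.

Lemma laurent_scalerAl c f g : c *: (f * g) = c *: f * g.
Proof. by rewrite [RHS]laurent_mulZl. Qed.

HB.instance Definition _ :=
  GRing.Lmodule_isLalgebra.Build F (laurent F) laurent_scalerAl.
HB.instance Definition _ := GRing.Lalgebra_isComAlgebra.Build F (laurent F).

Lemma tpow0 : tpow 0 = 1.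
Proof. by []. Qed.

Lemma tpowD i j : tpow (i + j) = tpow i * tpow j.
Proof. by rewrite [RHS]laurent_mul_tpow. Qed.

(** ** The substitutions [f(t) |-> f(t^-1)] and [f(t) |-> f(1)] *)

Definition tinv : laurent F -> laurent F := lext (fun k => tpow (- k)).

HB.instance Definition _ := GRing.Linear.on tinv.

Definition eval1 : laurent F -> F := @lext F^o (fun=> 1).

HB.instance Definition _ :=
  GRing.isLinear.Build F (laurent F) F *%R eval1
    (@lext_is_linear F^o (fun=> 1)).

Lemma eval1E f : eval1 f = \sum_(k <- msupp f) f@_k.
Proof. by apply: eq_bigr => k _; rewrite /GRing.scale /= mulr1. Qed.

Lemma tinv_tpow k : tinv (tpow k) = tpow (- k).
Proof. exact: lext_tpow. Qed.

Lemma eval1_tpow k : eval1 (tpow k) = 1.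
Proof. exact: (@lext_tpow F^o (fun=> 1)). Qed.

Lemma tinv_is_monoid_morphism : monoid_morphism tinv.
Proof.
split; first by rewrite -tpow0 tinv_tpow oppr0.
move=> f0; elim/laurent_ind: f0 => [|f g IHf IHg|c i] f1.
- by rewrite !(mul0r, raddf0).
- by rewrite !(mulrDl, raddfD) /= IHf IHg.
elim/laurent_ind: f1 => [|f g IHf IHg|d j].
- by rewrite !(mulr0, raddf0).
- by rewrite !(mulrDr, raddfD) /= IHf IHg.
rewrite -!(scalerAl, scalerAr) -tpowD !linearZ /= !tinv_tpow.
by rewrite -!(scalerAl, scalerAr) -tpowD opprD.
Qed.

HB.instance Definition _ :=
  GRing.isMonoidMorphism.Build (laurent F) (laurent F) tinv
    tinv_is_monoid_morphism.

Lemma eval1_is_monoid_morphism : monoid_morphism eval1.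
Proof.
split; first by rewrite -tpow0 eval1_tpow.
move=> f0; elim/laurent_ind: f0 => [|f g IHf IHg|c i] f1.
- by rewrite !(mul0r, raddf0).
- by rewrite !(mulrDl, raddfD) /= IHf IHg.
elim/laurent_ind: f1 => [|f g IHf IHg|d j].
- by rewrite !(mulr0, raddf0).
- by rewrite !(mulrDr, raddfD) /= IHf IHg.
rewrite -!(scalerAl, scalerAr) -tpowD !linearZ /= !eval1_tpow.
by rewrite !mulr1.
Qed.

HB.instance Definition _ :=
  GRing.isMonoidMorphism.Build (laurent F) F eval1 eval1_is_monoid_morphism.

End Laurent.

(** * The loop algebra L(gl_2)

    As a type it is ['M[laurent F]_2]; the alias carries the scaling by [F]
    instead of the one by [laurent F]. *)

Definition loop_gl2 (F : fieldType) : Type := 'M[laurent F]_2.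

Lemma mulmx_jacobi (R : comNzRingType) n (x y z : 'M[R]_n) :
  (x *m (y *m z - z *m y) - (y *m z - z *m y) *m x)
    + (y *m (z *m x - x *m z) - (z *m x - x *m z) *m y)
    + (z *m (x *m y - y *m x) - (x *m y - y *m x) *m z) = 0.
Proof.
rewrite !mulmxBr !mulmxBl !mulmxA; apply/matrixP=> i j; rewrite !mxE.
ring.
Qed.

Section LoopAlgebra.
Context (F : fieldType).
Implicit Types (c : F).

HB.instance Definition _ := GRing.Zmodule.copy (loop_gl2 F) 'M[laurent F]_2.
Implicit Types (x y z : loop_gl2 F).

Definition loop_scale c x : loop_gl2 F := \matrix_(i, j) (c *: x i j).

Lemma loop_scaleA c d x : loop_scale c (loop_scale d x) = loop_scale (c * d) x.
Proof. by apply/matrixP=> i j; rewrite !mxE scalerA. Qed.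

Lemma loop_scale1 : left_id 1 loop_scale.
Proof. by move=> x; apply/matrixP=> i j; rewrite !mxE scale1r. Qed.

Lemma loop_scaleDr : right_distributive loop_scale +%R.
Proof. by move=> c x y; apply/matrixP=> i j; rewrite !mxE scalerDr. Qed.

Lemma loop_scaleDl x : {morph loop_scale^~ x : c d / c + d}.
Proof. by move=> c d; apply/matrixP=> i j; rewrite !mxE scalerDl. Qed.

HB.instance Definition _ := GRing.Zmodule_isLmodule.Build F (loop_gl2 F)
  loop_scaleA loop_scale1 loop_scaleDr loop_scaleDl.

Definition loop_bracket x y : loop_gl2 F := x *m y - y *m x.

Lemma loop_mulZl c x y : loop_scale c x *m y = loop_scale c (x *m y).
Proof.
apply/matrixP=> i j; rewrite !mxE scaler_sumr.
by apply: eq_bigr => k _; rewrite mxE scalerAl.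
Qed.

Lemma loop_mulZr c x y : x *m loop_scale c y = loop_scale c (x *m y).
Proof.
apply/matrixP=> i j; rewrite !mxE scaler_sumr.
by apply: eq_bigr => k _; rewrite mxE scalerAr.
Qed.

Lemma loop_bracketDl x y z :
  loop_bracket (x + y) z = loop_bracket x z + loop_bracket y z.
Proof. by rewrite /loop_bracket mulmxDl mulmxDr opprD addrACA. Qed.

Lemma loop_bracketDr x y z :
  loop_bracket x (y + z) = loop_bracket x y + loop_bracket x z.
Proof. by rewrite /loop_bracket mulmxDl mulmxDr opprD addrACA. Qed.

Lemma loop_bracketZl c x y :
  loop_bracket (c *: x) y = c *: loop_bracket x y.
Proof. by rewrite /loop_bracket scalerBr loop_mulZl loop_mulZr. Qed.

Lemma loop_bracketZr c x y :
  loop_bracket x (c *: y) = c *: loop_bracket x y.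
Proof. by rewrite /loop_bracket scalerBr loop_mulZl loop_mulZr. Qed.

Lemma loop_bracketxx x : loop_bracket x x = 0.
Proof. exact: subrr. Qed.

Lemma loop_jacobi x y z :
  loop_bracket x (loop_bracket y z) + loop_bracket y (loop_bracket z x)
    + loop_bracket z (loop_bracket x y) = 0.
Proof. exact: mulmx_jacobi. Qed.

HB.instance Definition _ := Lmodule_isLieAlgebra.Build F (loop_gl2 F)
  loop_bracketDl loop_bracketDr loop_bracketZl loop_bracketZr
  loop_bracketxx loop_jacobi.


Definition mx2 (a b c d : laurent F) : loop_gl2 F :=
  \matrix_(i, j) (if i == 0 then if j == 0 then a else b
                  else if j == 0 then c else d).

Definition theta x : loop_gl2 F :=
  mx2 (tinv (x 1 1)) (tinv (x 1 0)) (tinv (x 0 1)) (tinv (x 0 0)).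

Definition epsilon x : F := eval1 (x 0 0) + eval1 (x 1 1).

Lemma loop_eqP x y :
  x 0 0 = y 0 0 -> x 0 1 = y 0 1 -> x 1 0 = y 1 0 -> x 1 1 = y 1 1 -> x = y.
Proof.
move=> e00 e01 e10 e11; apply/matrixP.
have I2P (i : 'I_2) : i = 0 \/ i = 1.
  by case: i => [[|[|//]] ?]; [left | right]; apply/val_inj.
by move=> i j; case: (I2P i) => ->; case: (I2P j) => ->.
Qed.

Lemma mulmx2E x y i j : (x *m y) i j = x i 0 * y 0 j + x i 1 * y 1 j.
Proof. by rewrite mxE big_ord_recl big_ord1; congr (_ + x i _ * y _ j); apply/val_inj. Qed.

Lemma loopDE x y i j : (x + y) i j = x i j + y i j.
Proof. exact: mxE. Qed.

Lemma loopZE c x i j : (c *: x) i j = c *: x i j.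
Proof. exact: mxE. Qed.

Lemma loop_bracketE x y i j :
  [lie x, y] i j =
    (x i 0 * y 0 j + x i 1 * y 1 j) - (y i 0 * x 0 j + y i 1 * x 1 j).
Proof. by rewrite -!mulmx2E [LHS]mxE [X in _ + X]mxE. Qed.

Lemma theta_is_linear : linear theta.
Proof.
by move=> c x y; apply: loop_eqP; rewrite loopDE loopZE !mxE /= linearP.
Qed.

HB.instance Definition _ :=
  GRing.isLinear.Build F (loop_gl2 F) (loop_gl2 F) *:%R theta theta_is_linear.

Lemma mx2E (a b c d : laurent F) :
  ((mx2 a b c d 0 0 = a) * (mx2 a b c d 0 1 = b)
    * (mx2 a b c d 1 0 = c) * (mx2 a b c d 1 1 = d))%type.
Proof. by rewrite !mxE. Qed.

Lemma theta_bracket : {morph theta : x y / [lie x, y]}.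
Proof.
move=> x y; apply: loop_eqP; rewrite loop_bracketE /theta !mx2E loop_bracketE;
  rewrite rmorphB !rmorphD !rmorphM /=; ring.
Qed.

Lemma theta_involutive : involutive theta.
Proof.
have tinvK : involutive (@tinv F).
  elim/laurent_ind=> [|f g IHf IHg|c k]; first by rewrite !raddf0.
    by rewrite !raddfD /= IHf IHg.
  by rewrite !linearZ /= !tinv_tpow opprK.
by move=> x; apply: loop_eqP; rewrite /theta !mx2E tinvK.
Qed.

Lemma epsilon_is_linear : scalar epsilon.
Proof.
move=> c x y; rewrite /epsilon !loopDE !loopZE !linearP /= mulrDr.
by rewrite addrACA.
Qed.

HB.instance Definition _ :=
  GRing.isLinear.Build F (loop_gl2 F) F *%R epsilon epsilon_is_linear.

Lemma epsilon_bracket x y : epsilon [lie x, y] = 0.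
Proof. by rewrite /epsilon !loop_bracketE !rmorphB !rmorphD !rmorphM /=; ring. Qed.

End LoopAlgebra.

Definition Oset (F : fieldType) : {pred loop_gl2 F} :=
  [pred x | (epsilon x == 0) && (theta x == x)].

Record Oalg (F : fieldType) : Type :=
  OAlg { Oval : loop_gl2 F; OvalP : Oval \in @Oset F }.

Section FixedSubalgebra.
Context (F : fieldType).

Lemma OsetP (x : loop_gl2 F) :
  reflect (epsilon x = 0 /\ theta x = x) (x \in @Oset F).
Proof. by apply: (iffP andP) => -[/eqP ? /eqP ?]. Qed.

Lemma Oset_submod : submod_closed (@Oset F).
Proof.
split=> [|c x y /OsetP[ex tx] /OsetP[ey ty]]; apply/OsetP.
  by rewrite !raddf0.
by rewrite !linearP /= ex ey tx ty mulr0 addr0.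
Qed.

HB.instance Definition _ :=
  GRing.isSubmodClosed.Build F (loop_gl2 F) (@Oset F) Oset_submod.

HB.instance Definition _ := [isSub for @Oval F].
HB.instance Definition _ := [Choice of Oalg F by <:].
HB.instance Definition _ := [SubChoice_isSubZmodule of Oalg F by <:].
HB.instance Definition _ := [SubZmodule_isSubLmodule of Oalg F by <:].
Implicit Types x y z : Oalg F.

Lemma Oset_bracket (x y : loop_gl2 F) :
  x \in @Oset F -> y \in @Oset F -> [lie x, y] \in @Oset F.
Proof.
move=> /OsetP[_ tx] /OsetP[_ ty]; apply/OsetP.
by rewrite epsilon_bracket theta_bracket tx ty.
Qed.

Definition Obracket x y : Oalg F := OAlg (Oset_bracket (OvalP x) (OvalP y)).

Lemma ObracketDl x y z : Obracket (x + y) z = Obracket x z + Obracket y z.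
Proof. by apply/val_inj; rewrite /= lieDl. Qed.

Lemma ObracketDr x y z : Obracket x (y + z) = Obracket x y + Obracket x z.
Proof. by apply/val_inj; rewrite /= lieDr. Qed.

Lemma ObracketZl c x y : Obracket (c *: x) y = c *: Obracket x y.
Proof. by apply/val_inj; rewrite /= lieZl. Qed.

Lemma ObracketZr c x y : Obracket x (c *: y) = c *: Obracket x y.
Proof. by apply/val_inj; rewrite /= lieZr. Qed.

Lemma Obracketxx x : Obracket x x = 0.
Proof. by apply/val_inj; rewrite /= liexx. Qed.

Lemma Ojacobi x y z :
  Obracket x (Obracket y z) + Obracket y (Obracket z x)
    + Obracket z (Obracket x y) = 0.
Proof. by apply/val_inj; rewrite /= lie_jacobi. Qed.

HB.instance Definition _ := Lmodule_isLieAlgebra.Build F (Oalg F)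
  ObracketDl ObracketDr ObracketZl ObracketZr Obracketxx Ojacobi.

Local Notation t := (tpow F 1).
Local Notation tV := (tpow F (- 1)).

Definition mxW0 : loop_gl2 F := mx2 0 1 1 0.
Definition mxW1 : loop_gl2 F := mx2 0 t tV 0.
Definition mxG (k : nat) : loop_gl2 F :=
  let f := (2^-1 *: (t + tV)) ^+ k in
  mx2 (f * (2 * tV - 2)) 0 0 (f * (2 * t - 2)).

Lemma mxW0_in : mxW0 \in @Oset F.
Proof.
apply/OsetP; split; first by rewrite /epsilon !mxE /= raddf0 addr0.
by apply: loop_eqP; rewrite !mxE /= ?raddf0 ?rmorph1.
Qed.

Lemma mxW1_in : mxW1 \in @Oset F.
Proof.
apply/OsetP; split; first by rewrite /epsilon !mxE /= raddf0 addr0.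
by apply: loop_eqP; rewrite !mxE /= ?raddf0 ?tinv_tpow ?opprK.
Qed.

Lemma mxG_in k : mxG k \in @Oset F.
Proof.
apply/OsetP; split.
  rewrite /epsilon !mxE /= !rmorphM !rmorphB !rmorphM !rmorph_nat /= !eval1_tpow.
  by rewrite mulr1 subrr !mulr0 addr0.
by apply: loop_eqP; rewrite !mxE /= ?raddf0 // rmorphM rmorphXn /= linearZ /=
  raddfD rmorphB rmorphM rmorph_nat /= !tinv_tpow ?opprK [_ + t]addrC.
Qed.

End FixedSubalgebra.

(* [genG k] stands for the generator with index k + 1. *)
Inductive Ogen : Type := genW0 | genW1 | genG of nat.

Definition Oelt (F : fieldType) (x : Ogen) : Oalg F :=
  match x with
  | genW0 => OAlg (mxW0_in F)
  | genW1 => OAlg (mxW1_in F)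
  | genG k => OAlg (mxG_in F k)
  end.

Section Relations.
Context (F : fieldType).
Local Open Scope lie_term_scope.
Local Notation W0 := (LieGen genW0).
Local Notation W1 := (LieGen genW1).
(* [G_ k], for positive [k], is the generator with index [k]. *)
Local Notation G_ k := (LieGen (genG k.-1)).

Inductive Orel : lie_term F Ogen -> lie_term F Ogen -> Prop :=
| Orel_W0W1 : Orel [lie W0, [lie W0, [lie W0, W1]]] (4 *: [lie W0, W1])
| Orel_W1W0 : Orel [lie W1, [lie W1, [lie W1, W0]]] (4 *: [lie W1, W0])
| Orel_W0G1 : Orel [lie W0, [lie W0, W1]] [lie W0, G_ 1]
| Orel_G1W1 : Orel [lie [lie W0, W1], W1] [lie G_ 1, W1]
| Orel_W0G k : (0 < k)%N ->
    Orel [lie W0, [lie W0, [lie W1, G_ k]]] (4 *: [lie W0, G_ k.+1])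
| Orel_GW1 k : (0 < k)%N ->
    Orel [lie [lie [lie G_ k, W0], W1], W1] (4 *: [lie G_ k.+1, W1])
| Orel_GG (k l : nat) : Orel [lie G_ k.+1, G_ l.+1] 0.

End Relations.

(* Main.v *)
From HB Require Import structures.
From mathcomp Require Import all_boot all_algebra ring zify.
From Stdlib Require Import FunctionalExtensionality.
Require Import Defs.

(** Write A_m for the element of O with off-diagonal entries t^m, t^-m, and
    diag(f) for the element of O with diagonal entries f(t), f(t^-1), where
    f(1) = 0.  Splitting f into its parts that are odd and even under
    t |-> t^-1 splits O as a direct sum of two ideals: the Onsager algebra,
    spanned by the A_m and the D_m = diag(t^m - t^-m), and an abelian ideal
    of scalar matrices, which is central in O.  The presented Lie algebra P
    splits in the same way, and this gives the inverse of the homomorphism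
    phi : P -> O that is defined by the relations.

    The Onsager half is the classical theorem of Onsager, Davies and Roan
    ([dolan_grady_onsager]): in any Lie algebra, two elements w0, w1 subject
    to the first two relations generate sequences a_m, d_m with
    [a_m, a_k] = d_{m-k} and [d_m, a_k] = 2 (a_{k+m} - a_{k-m}).  The sequence
    a_m is forced: a_{m+1} - a_{m-1} must be half of [[w1, w0], a_m].  The
    content is that [a_{k+n}, a_k] does not depend on k.  Once this is known for
    distances up to n, the bracket at distance n + 1 changes by a fixed amount e
    when k moves by one; computing the bracket of d_n with [w1, w0] = d_1 in two
    ways gives (2 n + 2) e = 0, so e = 0 in characteristic zero.  Distance 1
    needs an argument of its own ([dolan_grady_step]).

    For the central half, let G_{k+1} have upper left entry g and put
    c_k = 2 G_{k+1} - (the Onsager element of g - g(t^-1)) in P.  The third to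
    sixth relations say that G_{k+1} acts on w0 and w1 as it does in O, so c_k
    commutes with w0 and w1; the last relation then makes the c_k commute with
    each other ([central_generators], [central_central]).  The image of c_k in
    O is scalar, and these images form a basis of the central ideal.

    Expanding the symmetric polynomials t^m + t^-m - 2 in that basis is a
    three-term recurrence of Chebyshev type, solved directly inside P by the
    family kappa.  Together, these data define a linear map O -> P
    ([Oalg_lift]), which is a Lie homomorphism because the Onsager relations
    hold in P and the c_k are central.  It sends generators to generators, so
    its composite with phi on the side of P is the identity by the universal
    property; on the side of O the composite is computed on matrix entries
    ([Oalg_liftK]). *)

Set Implicit Arguments.
Unset Strict Implicit.
Unset Printing Implicit Defensive.
Import GRing.Theory.
Local Open Scope ring_scope.

(** * Linear identities in modules *)

(** An equality between linear combinations follows from equality of the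
    coefficients of each atom.  The tactic below reads off the coefficients
    and leaves them to the solvers for rings and fields; a bracket counts as an
    atom, and the scalars that are divided by must be known to be nonzero. *)

Section LinearExpressions.
Context (R : comNzRingType) (V : lmodType R).

Inductive lin_expr : Type :=
| LinAtom of nat
| LinZero
| LinAdd of lin_expr & lin_expr
| LinOpp of lin_expr
| LinScale of R & lin_expr.

Fixpoint lin_eval (env : seq V) (e : lin_expr) : V :=
  match e with
  | LinAtom i => env`_i
  | LinZero => 0
  | LinAdd e1 e2 => lin_eval env e1 + lin_eval env e2
  | LinOpp e1 => - lin_eval env e1
  | LinScale c e1 => c *: lin_eval env e1
  end.

Fixpoint lin_coef (i : nat) (e : lin_expr) : R :=
  match e with
  | LinAtom j => if Nat.eqb i j then 1 else 0
  | LinZero => 0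
  | LinAdd e1 e2 => lin_coef i e1 + lin_coef i e2
  | LinOpp e1 => - lin_coef i e1
  | LinScale c e1 => c * lin_coef i e1
  end.

Lemma lin_evalE env e :
  lin_eval env e = \sum_(i < size env) lin_coef i e *: env`_i.
Proof.
elim: e => [j||e1 IH1 e2 IH2|e1 IH1|c e1 IH1] /=.
- have [lt_j|le_j] := ltnP j (size env); last first.
    rewrite nth_default // big1 // => i _.
    case: PeanoNat.Nat.eqb_spec => [eq_ij|]; last by rewrite scale0r.
    by have := ltn_ord i; rewrite eq_ij ltnNge le_j.
  rewrite (bigD1 (Ordinal lt_j)) //= PeanoNat.Nat.eqb_refl scale1r.
  rewrite big1 ?addr0 // => i /eqP ne_ij.
  case: PeanoNat.Nat.eqb_spec => [eq_ij|]; last by rewrite scale0r.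
  by case: ne_ij; apply/val_inj.
- by rewrite big1 // => i _; rewrite scale0r.
- by rewrite IH1 IH2 -big_split; apply: eq_bigr => i _; rewrite scalerDl.
- by rewrite IH1 -sumrN; apply: eq_bigr => i _; rewrite scaleNr.
by rewrite IH1 scaler_sumr; apply: eq_bigr => i _; rewrite scalerA.
Qed.

Fixpoint lin_coef_eq (n : nat) (e1 e2 : lin_expr) : Prop :=
  if n is m.+1 then lin_coef m e1 = lin_coef m e2 /\ lin_coef_eq m e1 e2
  else True.

Lemma lin_eval_eq env e1 e2 :
  lin_coef_eq (size env) e1 e2 -> lin_eval env e1 = lin_eval env e2.
Proof.
rewrite !lin_evalE => eq_e; apply: eq_bigr => i _; congr (_ *: _).
elim: (size env) (nat_of_ord i) (ltn_ord i) eq_e => //= n IHn j.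
by rewrite ltnS leq_eqVlt => /orP[/eqP-> []|/IHn jn [_ /jn]].
Qed.

End LinearExpressions.

(** Atoms such as [a (m - 1)] can be convertible without being syntactically
    equal, since integer operations elaborate through different structures;
    convertibility is only tried when no atom matches syntactically. *)
Ltac lin_index_syntactic x env :=
  match env with
  | cons x _ => constr:(O)
  | cons _ ?env' => let i := lin_index_syntactic x env' in constr:(S i)
  end.

Ltac lin_index_convertible x env :=
  match env with
  | cons ?y _ => let _ := match goal with _ => unify x y end in constr:(O)
  | cons _ ?env' => let i := lin_index_convertible x env' in constr:(S i)
  end.

Ltac lin_index x env :=
  match goal with
  | _ => lin_index_syntactic x env
  | _ => lin_index_convertible x env
  end.

Ltac lin_atoms env x :=
  match x with
  | @GRing.add _ ?y ?z => let env' := lin_atoms env y in lin_atoms env' z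
  | @GRing.opp _ ?y => lin_atoms env y
  | @GRing.scale _ _ _ ?y => lin_atoms env y
  | @GRing.zero _ => env
  | _ => match goal with
         | _ => let i := lin_index x env in env
         | _ => constr:(cons x env)
         end
  end.

Ltac lin_reify R env x :=
  match x with
  | @GRing.add _ ?y ?z =>
      let e1 := lin_reify R env y in
      let e2 := lin_reify R env z in constr:(@LinAdd R e1 e2)
  | @GRing.opp _ ?y => let e := lin_reify R env y in constr:(@LinOpp R e)
  | @GRing.scale _ _ ?c ?y =>
      let e := lin_reify R env y in constr:(@LinScale R c e)
  | @GRing.zero _ => constr:(@LinZero R)
  | _ => let i := lin_index x env in constr:(@LinAtom R i)
  end.

Ltac lin_coefs :=
  lazymatch goal with
  | |- True => exact I
  | |- _ /\ _ => split; [first [ring | by field] | lin_coefs]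
  end.

Ltac lin_eq F V :=
  lazymatch goal with
  | |- @eq ?T ?x ?y =>
      let env := lin_atoms (@nil T) x in
      let env := lin_atoms env y in
      let e1 := lin_reify F env x in
      let e2 := lin_reify F env y in
      apply: (@lin_eval_eq F V env e1 e2);
      cbn [lin_coef_eq lin_coef size Nat.eqb];
      lin_coefs
  end.

(** * Identities in Lie algebras *)

Section LieIdentities.
Context (F : fieldType) (L : lieAlgType F).
Implicit Types x y z : L.

Lemma lieC x y : [lie x, y] = - [lie y, x].
Proof.
have := liexx (x + y); rewrite lieDl !lieDr !liexx add0r addr0.
by move=> /eqP; rewrite addr_eq0 => /eqP.
Qed.

Lemma lieNr x y : [lie x, - y] = - [lie x, y].
Proof. by rewrite -scaleN1r lieZr scaleN1r. Qed.

Lemma lieNl x y : [lie - x, y] = - [lie x, y].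
Proof. by rewrite -scaleN1r lieZl scaleN1r. Qed.

Lemma lie0r x : [lie x, 0] = 0.
Proof. by rewrite -[X in [lie x, X]](scale0r x) lieZr scale0r. Qed.

Lemma lie0l x : [lie 0, x] = 0.
Proof. by rewrite lieC lie0r oppr0. Qed.

(** The Jacobi identity, read as: bracketing with x is a derivation. *)
Lemma lie_der x y z :
  [lie x, [lie y, z]] = [lie [lie x, y], z] + [lie y, [lie x, z]].
Proof.
have := lie_jacobi x y z; rewrite (lieC z [lie x, y]) (lieC z x) lieNr => jac.
by rewrite -[RHS]add0r -jac; lin_eq F L.
Qed.

Lemma centralizer_bracket x y z :
  [lie x, y] = 0 -> [lie x, z] = 0 -> [lie x, [lie y, z]] = 0.
Proof. by move=> xy xz; rewrite lie_der xy xz lie0l lie0r addr0. Qed.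

Lemma centralizer_lext x (v : int -> L) b :
  (forall m, [lie x, v m] = 0) -> [lie x, lext v b] = 0.
Proof.
move=> xv; elim/laurent_ind: b=> [|b b' IHb IHb'|e m].
- by rewrite raddf0 lie0r.
- by rewrite raddfD lieDr IHb IHb' addr0.
by rewrite linearZ /= lieZr lext_tpow xv scaler0.
Qed.

Definition lieE :=
  (@lieDl F L, @lieDr F L, lieNl, lieNr, @lieZl F L, @lieZr F L, lie0l, lie0r).

End LieIdentities.

(** * Recurrences indexed by the integers *)

Section TwoSidedSequences.

Lemma two_sided_iter (T : Type) (f g : T -> T) (s0 : T) :
  cancel g f -> exists s : int -> T, s 0 = s0 /\ forall m, s (m + 1) = f (s m).
Proof.
move=> gK; exists (fun m => match m with
  | Posz n => iter n f s0 | Negz n => iter n.+1 g s0 end); split=> // -[n|[|n]].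
- by rewrite (_ : Posz n + 1 = n.+1) //; lia.
- by rewrite /= gK.
by rewrite (_ : Negz n.+1 + 1 = Negz n) /= ?gK //; lia.
Qed.

(** The hypothesis says that the recurrence can be run backwards, which is what
    extends the sequence to negative indices. *)
Lemma two_sided_rec (T : Type) (next prev : T -> T -> T) (x0 x1 : T) :
  (forall u v, next (prev u v) u = v) ->
  exists x : int -> T,
    [/\ x 0 = x0, x 1 = x1 & forall m, x (m + 2) = next (x m) (x (m + 1))].
Proof.
move=> nextK.
pose f (s : T * T) := (s.2, next s.1 s.2); pose g (s : T * T) := (prev s.1 s.2, s.1).
have gK : cancel g f by case=> u v; rewrite /f /g /= nextK.
have [s [s0 sS]] := two_sided_iter (x0, x1) gK.
have s2 m : (s m).2 = (s (m + 1)).1 by rewrite sS.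
exists (fun m => (s m).1); split; first by rewrite s0.
  by rewrite -(add0r 1) -s2 s0.
by move=> m; rewrite (_ : m + 2 = (m + 1) + 1) -?s2 ?sS //=; lia.
Qed.

Lemma two_sided_ind (P : int -> Prop) :
  P 0 -> P 1 ->
  (forall m, P m -> P (m + 1) -> P (m + 2)) ->
  (forall m, P (m + 1) -> P (m + 2) -> P m) -> forall m, P m.
Proof.
move=> P0 P1 PS PP m; suff: P m /\ P (m + 1) by case.
elim: m => [//|n [Pn Pn1]|n [Pn Pn1]].
  rewrite (_ : n.+1%:Z = n%:Z + 1); last by lia.
  by rewrite -addrA; split=> //; apply: PS.
have e1 : - n.+1%:Z + 1 = - n%:Z by lia.
have e2 : - n.+1%:Z + 2 = - n%:Z + 1 by lia.
by rewrite e1; split=> //; apply: PP; rewrite ?e1 ?e2.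
Qed.

End TwoSidedSequences.

(** * The Onsager algebra from the Dolan-Grady relations *)

Section Onsager.
Context (F : fieldType) (L : lieAlgType F).
Hypothesis charF0 : [pchar F] =i pred0.
Implicit Types (m n k : int).

Lemma natr_neq0_char0 (n : nat) : (n.+1%:R : F) != 0.
Proof. by move/pcharf0P: charF0 => ->. Qed.

Lemma scale_natr_inj (n : nat) : injective (fun x : L => n.+1%:R *: x).
Proof. exact: scalerI (natr_neq0_char0 n). Qed.

(** Three consecutive neighbour relations [a_{m+1}, a_m] = D force the next one.
    The derivation ad D shifts indices, so applying it to a known bracket gives
    relations between brackets at larger distance.  Set E = [a_1, a_{-1}], which
    also equals [a_2, a_0] and [a_3, a_1].  First ad D kills E: computing [D, E] from
    two expressions of E and [E, D] from D = [a_1, a_0] gives 3 [D, E] = 0.  Then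
    two ways of comparing [a_4, a_1] with [a_3, a_2], from E = [a_3, a_1] and from
    D = [a_2, a_1], can only agree if [a_3, a_2] = D. *)
Lemma dolan_grady_step (a : int -> L) (D : L) :
  (forall m, [lie D, a m] = 2 *: (a (m + 1) - a (m - 1))) ->
  [lie a 0, a (-1)] = D -> [lie a 1, a 0] = D -> [lie a 2, a 1] = D ->
  [lie a 3, a 2] = D.
Proof.
move=> R X0 X1 X2.
have R' m p q : p = m + 1 -> q = m - 1 -> [lie D, a m] = 2 *: (a p - a q).
  by move=> -> ->; exact: R.
have D0 := R' 0 1 (-1) erefl erefl.
have D1 := R' 1 2 0 erefl erefl.
have D2 := R' 2 3 1 erefl erefl.
have D3 := R' 3 4 2 erefl erefl.
have DN1 := R' (-1) 0 (-2) erefl erefl.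
have X0' : [lie a (-1), a 0] = - D by rewrite lieC X0.
have X1' : [lie a 0, a 1] = - D by rewrite lieC X1.
have X2' : [lie a 1, a 2] = - D by rewrite lieC X2.
pose E := [lie a 1, a (-1)].
have E20 : [lie a 2, a 0] = E.
  apply: (@scale_natr_inj 1); have := liexx D; rewrite -{2}X1 lie_der D1 D0 !lieE.
  rewrite !liexx -/E => e; rewrite -[LHS]subr0 -e; lin_eq F L.
have E31 : [lie a 3, a 1] = E.
  apply: (@scale_natr_inj 1); have := liexx D; rewrite -{2}X2 lie_der D1 D2 !lieE.
  rewrite !liexx E20 => e; rewrite -[LHS]subr0 -e; lin_eq F L.
have Ea1 : [lie E, a 1] = 2 *: (a 3 - a (-1)).
  rewrite lieC -E20 lie_der X2' X1 !lieE (lieC _ D) D0 D2; lin_eq F L.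
have Ea0 : [lie E, a 0] = 2 *: (a 2 - a (-2)).
  rewrite lieC /E lie_der X1' X0 !lieE (lieC _ D) D1 DN1; lin_eq F L.
have DE0 : [lie D, E] = 0.
  have e1 : [lie D, E] = 2 *: ([lie a 3, a 0] - [lie a 2, a (-1)]).
    rewrite -E20 lie_der D2 D0 !lieE X1 X2; lin_eq F L.
  have e2 : [lie D, E] = 2 *: ([lie a 2, a (-1)] - [lie a 1, a (-2)]).
    rewrite /E lie_der D1 DN1 !lieE X0 X1; lin_eq F L.
  have e3 : [lie E, D] = 2 *: ([lie a 3, a 0] - [lie a 1, a (-2)]).
    rewrite -{1}X1 lie_der Ea1 Ea0 !lieE X2' X0'; lin_eq F L.
  apply: (@scale_natr_inj 2); rewrite scaler0.
  transitivity ([lie D, E] + [lie D, E] - [lie E, D]).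
    rewrite (lieC E D); lin_eq F L.
  rewrite e3 {1}e1 e2; lin_eq F L.
have Ea2 : [lie E, a 2] = 2 *: (a 4 - a 0).
  have e : 2 *: a 2 = [lie D, a 1] + 2 *: a 0 by rewrite D1; lin_eq F L.
  apply: (@scale_natr_inj 1); rewrite -[LHS]lieZr e !lieE Ea0.
  rewrite lie_der (lieC E D) DE0 oppr0 lie0l Ea1 !lieE D3 DN1; lin_eq F L.
have e1 : 2 *: ([lie a 4, a 1] - D + [lie a 3, a 2] - [lie a 3, a 0]) = 0.
  rewrite -DE0 -E31 lie_der D3 D1 !lieE X2; lin_eq F L.
have e2 : 2 *: ([lie a 4, a 1] + D - [lie a 3, a 2] - [lie a 2, a (-1)]) = 0.
  have : [lie E, D] = 0 by rewrite lieC DE0 oppr0.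
  rewrite -{1}X2 lie_der Ea2 Ea1 !lieE X1' (lieC (a 2) (a 3)) => <-; lin_eq F L.
have e3 : 2 *: ([lie a 3, a 0] - [lie a 2, a (-1)]) = 0.
  rewrite -DE0 -E20 lie_der D2 D0 !lieE X1 X2; lin_eq F L.
apply: (@scale_natr_inj 3).
rewrite -[LHS]subr0 -e1 -[LHS]addr0 -{1}e2 -[LHS]subr0 -e3.
lin_eq F L.
Qed.

(** The previous step applies to every translate of the sequence, and to its
    mirror image m |-> a_{-m} with D replaced by -D. *)
Lemma dolan_grady_neighbours (a : int -> L) (D : L) :
  (forall m, [lie D, a m] = 2 *: (a (m + 1) - a (m - 1))) ->
  [lie a 0, a (-1)] = D -> [lie a 1, a 0] = D -> [lie a 2, a 1] = D ->
  forall m, [lie a (m + 1), a m] = D.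
Proof.
move=> R X0 X1 X2 m.
suff: [/\ [lie a (m + 1), a m] = D, [lie a m, a (m - 1)] = D
        & [lie a (m + 2), a (m + 1)] = D] by case.
elim: m => [//|n [Xn Xp Xs]|n [Xn Xp Xs]].
- rewrite (_ : n.+1%:Z = n%:Z + 1); last by lia.
  rewrite addrK -!addrA; split=> //.
  apply: (dolan_grady_step (a := fun m => a (n%:Z + m))).
  + by move=> m; rewrite R !addrA.
  + by rewrite addr0.
  + by rewrite addr0.
  + exact: Xs.
- rewrite (_ : - n.+1%:Z = - n%:Z - 1); last by lia.
  rewrite (_ : - n%:Z - 1 + 1 = - n%:Z); last by lia.
  rewrite (_ : - n%:Z - 1 + 2 = - n%:Z + 1); last by lia.
  split=> //; rewrite [LHS]lieC; apply: (canLR (@opprK L)).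
  have := @dolan_grady_step (fun m => a (- n%:Z + 1 - m)) (- D).
  rewrite (_ : - n%:Z + 1 - 3 = - n%:Z - 1 - 1); last by lia.
  rewrite (_ : - n%:Z + 1 - 2 = - n%:Z - 1); last by lia.
  rewrite addrK subr0 opprK -addrA.
  apply.
  + move=> m; rewrite lieNl R; rewrite (_ : _ + 1 = - n%:Z + 1 - (m - 1)); last by lia.
    rewrite (_ : _ - m - 1 = - n%:Z + 1 - (m + 1)); last by lia.
    lin_eq F L.
  + by rewrite lieC Xs.
  + by rewrite lieC Xn.
  + by rewrite lieC Xp.
Qed.

Section Ladder.
Variables (a : int -> L) (D : L).
Hypothesis aD : forall m, [lie D, a m] = 2 *: (a (m + 1) - a (m - 1)).
Hypothesis a_next : forall m, [lie a (m + 1), a m] = D.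

Let d m := [lie a m, a 0].
Let bracket_at m := forall k, [lie a (k + m), a k] = d m.
Let action_at m := forall k, [lie d m, a k] = 2 *: (a (k + m) - a (k - m)).

(** With d_{m+1} written as [a_{k+m}, a_{k-1}], the Jacobi identity reduces its
    action on a_k to the actions of d_m and of d_1 = D.  Starting at k - 1 makes
    a_k a neighbour of one argument and leaves it at distance m from the other. *)
Lemma onsager_action_step m :
  bracket_at m -> bracket_at (m + 1) -> action_at m -> action_at (m + 1).
Proof.
move=> Bm Bm1 Cm k.
rewrite -(Bm1 (k - 1)) lieC lie_der.
have e1 : k - 1 + (m + 1) = k + m by lia.
have e2 : [lie a k, a (k + m)] = - d m by rewrite lieC Bm.
have e3 : [lie a k, a (k - 1)] = D by rewrite -{1}[k](subrK 1) a_next.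
rewrite e1 e2 e3 !lieE Cm (lieC _ D) aD.
have -> : k - 1 + m = k + m - 1 by lia.
have -> : k - 1 - m = k - (m + 1) by lia.
have -> : k + m + 1 = k + (m + 1) by lia.
lin_eq F L.
Qed.

(** The brackets X_k at distance m + 1 form an arithmetic progression whose
    common difference is e = [D, d_m] / 2.  Expanding [d_m, D] with
    D = [a_1, a_0] gives 2 (X_0 - X_{-m}) = 2 m e, while it is also -2 e.  Hence
    2 (m + 1) e = 0. *)
Lemma onsager_bracket_step m (n : nat) : m = n :> int ->
  bracket_at (m - 1) -> bracket_at m -> action_at m -> bracket_at (m + 1).
Proof.
move=> mE Bp Bm Cm; pose X k := [lie a (k + (m + 1)), a k].
have Xdiff k : [lie D, d m] = 2 *: (X k - X (k - 1)).
  rewrite -(Bm k) lie_der !aD !lieE /X.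
  have -> : k + m + 1 = k + (m + 1) by lia.
  have -> : k + m - 1 = k + (m - 1) by lia.
  have -> : k - 1 + (m + 1) = k + m by lia.
  rewrite (_ : [lie a (k + m), a (k + 1)] = d (m - 1)); last first.
    by rewrite -(Bp (k + 1)); congr [lie a _, _]; lia.
  rewrite Bp; lin_eq F L.
have Xtel (j : nat) : 2 *: (X 0 - X (- j%:Z)) = j%:R *: [lie D, d m].
  elim: j => [|j IH]; first by rewrite oppr0 subrr scaler0 scale0r.
  rewrite -(natr1 j) [RHS]scalerDl scale1r -IH (Xdiff (- j%:Z)).
  rewrite (_ : - j.+1%:Z = - j%:Z - 1); last by lia.
  lin_eq F L.
have De0 : [lie D, d m] = 0.
  apply: (@scale_natr_inj n); rewrite scaler0 -(natr1 n) [LHS]scalerDl scale1r -Xtel -mE.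
  have -> : [lie D, d m] = - [lie d m, [lie a (0 + 1), a 0]] by rewrite a_next lieC.
  rewrite lie_der !Cm !lieE /X !add0r.
  rewrite [1 + m]addrC (_ : - m + (m + 1) = 1); last by lia.
  rewrite (_ : [lie a (1 - m), a 0] = - d (m - 1)); last first.
    rewrite lieC -(Bp (1 - m)); congr (- [lie a _, _]); lia.
  rewrite (_ : [lie a 1, a m] = - d (m - 1)); last first.
    rewrite lieC -(Bp 1); congr (- [lie a _, _]); lia.
  lin_eq F L.
have Xshift k : X k = X (k - 1).
  apply/eqP; rewrite -subr_eq0; apply/eqP/(@scale_natr_inj 1).
  by rewrite -Xdiff De0 scaler0.
have X0E k : X k = X 0.
  elim: k => // j <-.
    by rewrite Xshift; congr X; lia.
  by rewrite [RHS]Xshift; congr X; lia.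
by move=> k; rewrite -/(X k) X0E /X add0r.
Qed.

Lemma onsager_relations_nat (n : nat) : bracket_at n /\ action_at n.
Proof.
suff: [/\ bracket_at n, action_at n, bracket_at (n%:Z + 1) & action_at (n%:Z + 1)].
  by case.
elim: n => [|n [Bn Cn Bn1 Cn1]].
  have B0 : bracket_at 0 by move=> k; rewrite addr0 liexx /d liexx.
  have C0 : action_at 0.
    by move=> k; rewrite /d liexx lie0l oppr0 !addr0 subrr scaler0.
  have B1 : bracket_at (0 + 1) by move=> k; rewrite a_next /d add0r -(a_next 0).
  by split=> //; exact: onsager_action_step.
rewrite (_ : n.+1%:Z = n%:Z + 1); last by lia.
have B2 : bracket_at (n%:Z + 1 + 1).
  by apply: (@onsager_bracket_step _ n.+1) => //; [lia | rewrite addrK].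
by split=> //; exact: onsager_action_step.
Qed.

Lemma onsager_bracket m k : [lie a m, a k] = d (m - k).
Proof.
suff B n : bracket_at n by rewrite -(B (m - k) k) addrC subrK.
have nonneg (j : nat) : bracket_at j by have [] := onsager_relations_nat j.
case: (intP n) => [|j|j]; [exact: (nonneg 0) | exact: nonneg |].
move=> i; have [B _] := onsager_relations_nat j.+1.
have -> : d (- j.+1%:Z) = - d j.+1 by rewrite -(B (- j.+1%:Z)) addNr -lieC.
by rewrite lieC -{1}[i](subrK j.+1%:Z) B.
Qed.

Lemma onsager_action m k : [lie d m, a k] = 2 *: (a (k + m) - a (k - m)).
Proof.
have nonneg (n : nat) : action_at n by have [] := onsager_relations_nat n.
case: (intP m) => [|j|j]; [exact: (nonneg 0) | exact: nonneg |].
have -> : d (- j.+1%:Z) = - d j.+1.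
  by rewrite -[- j.+1%:Z]sub0r -onsager_bracket lieC.
by rewrite lieNl nonneg opprK; lin_eq F L.
Qed.

End Ladder.

(** Here d_1 = [w1, w0], and the relation for d_1 is the recurrence that defines
    the a_m.  The two Dolan-Grady relations are exactly the neighbour relations
    [a_0, a_{-1}] = d_1 and [a_2, a_1] = d_1. *)
Theorem dolan_grady_onsager (w0 w1 : L) :
  [lie w0, [lie w0, [lie w0, w1]]] = 4 *: [lie w0, w1] ->
  [lie w1, [lie w1, [lie w1, w0]]] = 4 *: [lie w1, w0] ->
  exists a d : int -> L,
    [/\ a 0 = w0, a 1 = w1, d 1 = [lie w1, w0],
        forall m k, [lie a m, a k] = d (m - k)
      & forall m k, [lie d m, a k] = 2 *: (a (k + m) - a (k - m))].
Proof.
move=> dg0 dg1; pose D := [lie w1, w0].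
pose next u v := u + 2^-1 *: [lie D, v].
pose prev u v := v - 2^-1 *: [lie D, u].
have nextK u v : next (prev u v) u = v by rewrite /next /prev subrK.
have [a [a0 a1 aS]] := two_sided_rec w0 w1 nextK.
have aD m : [lie D, a m] = 2 *: (a (m + 1) - a (m - 1)).
  have := aS (m - 1); rewrite subrK (_ : m - 1 + 2 = m + 1); last by lia.
  move=> ->; rewrite /next addrAC subrr add0r scalerA divff ?scale1r //.
  exact: (natr_neq0_char0 1).
have w01 : [lie w0, w1] = - D by rewrite lieC.
have aX0 : [lie a 1, a 0] = D by rewrite a0 a1.
have aX1 : [lie a 2, a 1] = D.
  apply: (@scale_natr_inj 1); rewrite -[LHS]lieZl.
  have -> : 2 *: a 2 = [lie D, a 1] + 2 *: a 0.
    by rewrite aD (_ : 1 + 1 = 2) // subrr; lin_eq F L.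
  rewrite !lieE a0 a1 w01 [[lie [lie D, w1], w1]]lieC [[lie D, w1]]lieC !lieE dg1.
  rewrite -/D; lin_eq F L.
have aXN1 : [lie a 0, a (-1)] = D.
  apply: (@scale_natr_inj 1); rewrite -[LHS]lieZr.
  have -> : 2 *: a (-1) = 2 *: a 1 - [lie D, a 0].
    by rewrite aD add0r sub0r; lin_eq F L.
  rewrite !lieE a0 a1 [[lie D, w0]]lieC -[D]opprK -w01 !lieE dg0.
  rewrite w01; lin_eq F L.
have a_next := dolan_grady_neighbours aD aXN1 aX0 aX1.
exists a, (fun m => [lie a m, a 0]); split=> //.
  exact: (onsager_bracket aD a_next).
exact: (onsager_action aD a_next).
Qed.

End Onsager.

(** * Laurent polynomials *)

Section LaurentLemmas.
Context (F : fieldType).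
Local Notation t := (tpow F 1).
Local Notation tV := (tpow F (- 1)).

Lemma tpowVK m : tpow F m * tpow F (- m) = 1.
Proof. by rewrite -tpowD subrr tpow0. Qed.

Lemma tinvK : involutive (@tinv F).
Proof.
elim/laurent_ind=> [|f g IHf IHg|c k]; first by rewrite !raddf0.
  by rewrite !raddfD /= IHf IHg.
by rewrite !linearZ /= !tinv_tpow opprK.
Qed.

Lemma eval1_tinv (f : laurent F) : eval1 (tinv f) = eval1 f.
Proof.
elim/laurent_ind: f=> [|f g IHf IHg|c k]; first by rewrite !raddf0.
  by rewrite !raddfD /= IHf IHg.
by rewrite !linearZ /= tinv_tpow !eval1_tpow.
Qed.

Lemma tinvB (f g : laurent F) : tinv (f - g) = tinv f - tinv g.
Proof. exact: raddfB. Qed.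

Lemma tinvM (f g : laurent F) : tinv (f * g) = tinv f * tinv g.
Proof. exact: rmorphM. Qed.

Lemma tinv0 : tinv (0 : laurent F) = 0.
Proof. exact: raddf0. Qed.

Lemma tinv1 : tinv (1 : laurent F) = 1.
Proof. exact: rmorph1. Qed.

Definition tinvE := (tinvB, tinvM, tinv0, tinv1, tinv_tpow, tinvK).

Definition tmean : laurent F := 2^-1 *: (t + tV).

(** The upper left entry of the generator with index k + 1. *)
Definition gdiag (k : nat) : laurent F := tmean ^+ k * (2 * tV - 2).

Lemma tmean_tpow m : tmean * tpow F m = 2^-1 *: (tpow F (m + 1) + tpow F (m - 1)).
Proof. by rewrite -scalerAl mulrDl -!tpowD ![_ + m]addrC. Qed.

Lemma gdiagS k : gdiag k.+1 = tmean * gdiag k.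
Proof. by rewrite /gdiag exprS mulrA. Qed.

Lemma tinv_tmean : tinv tmean = tmean.
Proof. by rewrite linearZ raddfD /= !tinv_tpow opprK addrC. Qed.

Lemma eval1_gdiag k : eval1 (gdiag k) = 0.
Proof.
by rewrite rmorphM rmorphB rmorphM rmorph_nat /= eval1_tpow mulr1 subrr mulr0.
Qed.

End LaurentLemmas.

(** * The algebra O through the first rows of its matrices *)

(** An element of O is determined by its first row, since the second row is its
    image under t |-> t^-1. *)

Section EntryRelations.
Variables (R : comNzRingType) (bar : {rmorphism R -> R}).
Implicit Types x y : R * R.

(** The commutator in O in terms of first rows.  It is stated over an arbitrary
    commutative ring with an involution, where checking the relations is a
    polynomial identity and no computation with Laurent polynomials occurs. *)
Definition entry_bracket x y : R * R :=
  (x.2 * bar y.2 - y.2 * bar x.2,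
   (x.1 - bar x.1) * y.2 - (y.1 - bar y.1) * x.2).
Local Notation "[ x , y ]" := (entry_bracket x y).
Local Notation "n ** x" := ((n * x.1, n * x.2) : R * R) (at level 40).

Variables (t tV : R) (q : nat -> R).
Hypothesis barK : involutive bar.
Hypotheses (bar_t : bar t = tV) (bar_tV : bar tV = t) (ttV : t * tV = 1).
Hypothesis q0 : q 0 = 2 * tV - 2.
Hypothesis qS : forall k, 2 * q k.+1 = (t + tV) * q k.

Let W0 : R * R := (0, 1).
Let W1 : R * R := (0, t).
Let G k : R * R := (q k, 0).

Let barE := (rmorphB bar, rmorphM bar, rmorph0 bar, rmorph1 bar, barK, bar_t, bar_tV).

Lemma entry_relations :
  [/\ [W0, [W0, [W0, W1]]] = 4 ** [W0, W1],
      [W1, [W1, [W1, W0]]] = 4 ** [W1, W0],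
      [W0, [W0, W1]] = [W0, G 0] &
      [[W0, W1], W1] = [G 0, W1]] /\
  [/\ forall k, [W0, [W0, [W1, G k]]] = 4 ** [W0, G k.+1],
      forall k, [[[G k, W0], W1], W1] = 4 ** [G k.+1, W1] &
      forall k l, [G k, G l] = (0, 0)].
Proof.
have barq0 : bar (q 0) = 2 * t - 2.
  by rewrite q0 rmorphB rmorphM rmorph_nat /= bar_tV.
have barqS k : 2 * bar (q k.+1) = (t + tV) * bar (q k).
  rewrite -(rmorph_nat bar) -rmorphM qS rmorphM rmorphD /=.
  by rewrite bar_t bar_tV [tV + t]addrC.
have qd k : 4 * (q k.+1 - bar (q k.+1)) = 2 * ((t + tV) * (q k - bar (q k))).
  by rewrite mulrBr mulrBr -qS -barqS; ring.
split; split; [| | | |move=> k|move=> k|move=> k l]; rewrite /entry_bracket /=;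
  congr (_, _); rewrite ?barE; try (ring: ttV q0 barq0).
  rewrite [RHS](_ : _ = - (4 * (q k.+1 - bar (q k.+1)))); last by ring.
  by rewrite qd; ring.
rewrite [RHS](_ : _ = t * (4 * (q k.+1 - bar (q k.+1)))); last by ring.
by rewrite qd; ring.
Qed.

End EntryRelations.

Section FixedSubalgebraEntries.
Context (F : fieldType).
Implicit Types x y : Oalg F.

Definition diag_entry x : laurent F := Oval x 0 0.
Definition off_entry x : laurent F := Oval x 0 1.

Lemma Oval11 x : Oval x 1 1 = tinv (diag_entry x).
Proof. by have /OsetP[_ {1}<-] := OvalP x; rewrite mx2E. Qed.

Lemma Oval10 x : Oval x 1 0 = tinv (off_entry x).
Proof. by have /OsetP[_ {1}<-] := OvalP x; rewrite mx2E. Qed.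

Lemma Oalg_eq x y :
  diag_entry x = diag_entry y -> off_entry x = off_entry y -> x = y.
Proof.
move=> exy fxy; apply/val_inj/loop_eqP => //=.
  by rewrite !Oval10 fxy.
by rewrite !Oval11 exy.
Qed.

Fact diag_entry_linear : linear diag_entry.
Proof. by move=> c x y; rewrite /diag_entry loopDE loopZE. Qed.
HB.instance Definition _ :=
  GRing.isLinear.Build F (Oalg F) (laurent F) *:%R diag_entry diag_entry_linear.

Fact off_entry_linear : linear off_entry.
Proof. by move=> c x y; rewrite /off_entry loopDE loopZE. Qed.
HB.instance Definition _ :=
  GRing.isLinear.Build F (Oalg F) (laurent F) *:%R off_entry off_entry_linear.

Lemma diag_entry_bracket x y :
  diag_entry [lie x, y] =
    off_entry x * tinv (off_entry y) - off_entry y * tinv (off_entry x).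
Proof. by rewrite /diag_entry loop_bracketE !Oval10 /off_entry; ring. Qed.

Lemma off_entry_bracket x y :
  off_entry [lie x, y] =
    (diag_entry x - tinv (diag_entry x)) * off_entry y
      - (diag_entry y - tinv (diag_entry y)) * off_entry x.
Proof.
by rewrite {1}/off_entry loop_bracketE !Oval11 /diag_entry /off_entry; ring.
Qed.

Lemma eval1_diag_entry x : (2 : F) != 0 -> eval1 (diag_entry x) = 0.
Proof.
move=> n2; have /OsetP[e _] := OvalP x; apply: (mulfI n2); rewrite mulr0 -e.
rewrite /epsilon Oval11 eval1_tinv /diag_entry; ring.
Qed.

Lemma diag_entry_G k : diag_entry (Oelt F (genG k)) = gdiag F k.
Proof. by rewrite /diag_entry /= mx2E. Qed.

Lemma off_entry_G k : off_entry (Oelt F (genG k)) = 0.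
Proof. by rewrite /off_entry /= mx2E. Qed.

Lemma diag_entry_W0 : diag_entry (Oelt F genW0) = 0.
Proof. by rewrite /diag_entry /= mx2E. Qed.

Lemma off_entry_W0 : off_entry (Oelt F genW0) = 1.
Proof. by rewrite /off_entry /= mx2E. Qed.

Lemma diag_entry_W1 : diag_entry (Oelt F genW1) = 0.
Proof. by rewrite /diag_entry /= mx2E. Qed.

Lemma off_entry_W1 : off_entry (Oelt F genW1) = tpow F 1.
Proof. by rewrite /off_entry /= mx2E. Qed.

Definition entries x : laurent F * laurent F := (diag_entry x, off_entry x).

Lemma entries_inj : injective entries.
Proof. by move=> x y [dxy oxy]; apply: Oalg_eq. Qed.

Lemma entries_bracket x y :
  entries [lie x, y] = entry_bracket (@tinv F) (entries x) (entries y).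
Proof. by rewrite /entries diag_entry_bracket off_entry_bracket. Qed.

Lemma entriesZ (n : nat) x :
  entries (n%:R *: x) = (n%:R * (entries x).1, n%:R * (entries x).2).
Proof. by rewrite /entries !linearZ /= !scaler_nat !mulr_natl. Qed.

Lemma entries0 : entries 0 = (0, 0).
Proof. by rewrite /entries !raddf0. Qed.

(** Quantifying over all families with the right first rows, rather than
    speaking of the generators themselves, keeps the matrices folded during
    rewriting. *)
Lemma Orel_entries (x : Ogen -> Oalg F) :
  (2 : F) != 0 ->
  entries (x genW0) = (0, 1) -> entries (x genW1) = (0, tpow F 1) ->
  (forall k, entries (x (genG k)) = (gdiag F k, 0)) ->
  forall s1 s2, Orel s1 s2 -> lie_eval x s1 = lie_eval x s2.
Proof.
move=> n2 W0e W1e Ge.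
have tmean2 : 2 * tmean F = tpow F 1 + tpow F (-1).
  by rewrite /tmean mulr_natl -scaler_nat scalerA divff // scale1r.
have q0 : gdiag F 0 = 2 * tpow F (-1) - 2 by rewrite /gdiag expr0 mul1r.
have qS k : 2 * gdiag F k.+1 = (tpow F 1 + tpow F (-1)) * gdiag F k.
  by rewrite gdiagS mulrA tmean2.
have [[r1 r2 r3 r4] [r5 r6 r7]] := entry_relations (@tinvK F)
  (tinv_tpow F 1) (tinv_tpow F (-1)) (tpowVK F 1) q0 qS.
move=> s1 s2; case=> [||||[//|k] _|[//|k] _|k l]; cbn [lie_eval predn];
  apply: entries_inj;
  rewrite ?entriesZ ?entries0 !(entries_bracket, W0e, W1e, Ge).
- exact: r1.
- exact: r2.
- exact: r3.
- exact: r4.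
- exact: r5.
- exact: r6.
- exact: r7.
Qed.

End FixedSubalgebraEntries.

(** * Lifting O along Onsager sequences and central elements *)

(** The element kappa m k stands for f^k (t^m + t^-m - 2), f = (t + t^-1) / 2,
    where c k stands for 2 f^k (t + t^-1 - 2).  The recurrence is
      t^(m+2) + t^-(m+2) - 2
        = 2 f (t^(m+1) + t^-(m+1) - 2) - (t^m + t^-m - 2) + 2 (2 f - 2)
    multiplied by f^k.  Letting k vary makes multiplication by f the shift of a
    sequence of vectors, so that no polynomial in f is needed. *)
Fact kappa_exists (F : fieldType) (V : lmodType F) (c : nat -> V) :
  exists kappa : int -> nat -> V,
  [/\ kappa 0 = (fun=> 0), kappa 1 = (fun k => 2^-1 *: c k)
    & forall m k, kappa (m + 2) k = 2 *: kappa (m + 1) k.+1 - kappa m k + c k].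
Proof.
pose next (u v : nat -> V) k := 2 *: v k.+1 - u k + c k.
have nextK u v : next (next v u) u = v.
  by apply: functional_extensionality => k; rewrite /next; lin_eq F V.
have [x [x0 x1 xS]] := two_sided_rec (fun=> 0) (fun k => 2^-1 *: c k) nextK.
by exists x; split=> // m k; rewrite xS.
Qed.

Section OnsagerSequences.
Context (F : fieldType) (L : lieAlgType F).
Hypothesis charF0 : [pchar F] =i pred0.
Variables (a d : int -> L).
Hypothesis aa : forall m k, [lie a m, a k] = d (m - k).
Hypothesis da : forall m k, [lie d m, a k] = 2 *: (a (k + m) - a (k - m)).

Let n2 : (2 : F) != 0 := natr_neq0_char0 charF0 1.
Let scale2_inj := @scale_natr_inj F L charF0 1.

Lemma d_opp m : d (- m) = - d m.
Proof. by rewrite -[- m]sub0r -aa lieC aa subr0. Qed.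

Lemma d0 : d 0 = 0.
Proof. by rewrite -(subrr 0) -aa liexx. Qed.

Lemma dd m k : [lie d m, d k] = 0.
Proof.
rewrite -[k]subr0 -aa lie_der !da !lieE !aa !subr0 !add0r.
rewrite -[k + m]opprK d_opp; have -> : - (k + m) = - m - k by lia.
have -> : k - - m = k + m by lia.
rewrite -[k + m]opprK d_opp; have -> : - (k + m) = - m - k by lia.
lin_eq F L.
Qed.

(** The lifts of the matrix with first row (0, b) and of diag(b - b(t^-1)). *)
Definition alpha : laurent F -> L := lext a.
HB.instance Definition _ := GRing.Linear.on alpha.
Definition delta : laurent F -> L := lext d.
HB.instance Definition _ := GRing.Linear.on delta.

Lemma alpha_tpow m : alpha (tpow F m) = a m. Proof. exact: lext_tpow. Qed.
Lemma delta_tpow m : delta (tpow F m) = d m. Proof. exact: lext_tpow. Qed.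

Lemma delta_tmean_tpow m :
  delta (tmean F * tpow F m) = 2^-1 *: (d (m + 1) + d (m - 1)).
Proof. by rewrite tmean_tpow linearZ; congr (_ *: _); rewrite raddfD /= !delta_tpow. Qed.

(** This identity and the next match the two relations that produce G_{k+2} from
    G_{k+1}: on diagonal Onsager elements, both iterated brackets are
    multiplication by 4 f, where f = (t + t^-1) / 2. *)
Lemma delta_tmean_left b : [lie a 0, [lie a 1, delta b]] = 4 *: delta (tmean F * b).
Proof.
elim/laurent_ind: b=> [|b b' IHb IHb'|c m].
- by rewrite mulr0 !raddf0 !lie0r.
- by rewrite mulrDr !raddfD !lieE IHb IHb'.
rewrite -scalerAr !linearZ /= delta_tmean_tpow delta_tpow !lieE.
rewrite (lieC (a 1)) da !lieE !aa !sub0r !d_opp.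
rewrite (_ : 1 - m = - (m - 1)) ?d_opp; last by lia.
by rewrite [1 + m]addrC; lin_eq F L.
Qed.

Lemma delta_tmean_right b : [lie [lie delta b, a 0], a 1] = 4 *: delta (tmean F * b).
Proof.
elim/laurent_ind: b=> [|b b' IHb IHb'|c m].
- by rewrite mulr0 !raddf0 !lie0l.
- by rewrite mulrDr !raddfD !lieE IHb IHb'.
rewrite -scalerAr !linearZ /= delta_tmean_tpow delta_tpow !lieE.
rewrite da !lieE !aa !add0r (_ : - m - 1 = - (m + 1)) ?d_opp; last by lia.
by lin_eq F L.
Qed.

Lemma delta_tinv b : delta (tinv b) = - delta b.
Proof.
elim/laurent_ind: b=> [|b b' IHb IHb'|c m].
- by rewrite tinv0 raddf0 oppr0.
- by rewrite !raddfD /= IHb IHb'.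
by rewrite !linearZ /= tinv_tpow !delta_tpow d_opp scalerN.
Qed.

Lemma delta_delta b b' : [lie delta b, delta b'] = 0.
Proof.
apply: centralizer_lext => k; rewrite lieC centralizer_lext ?oppr0 // => m.
exact: dd.
Qed.

Lemma alpha_alpha b b' : [lie alpha b, alpha b'] = delta (b * tinv b').
Proof.
elim/laurent_ind: b=> [|b1 b2 IH1 IH2|c m].
- by rewrite mul0r !raddf0 lie0l.
- by rewrite mulrDl !raddfD lieDl IH1 IH2.
rewrite -scalerAl !linearZ /= lieZl alpha_tpow; congr (_ *: _).
elim/laurent_ind: b'=> [|b1 b2 IH1 IH2|c' m'].
- by rewrite tinv0 mulr0 !raddf0 lie0r.
- by rewrite raddfD lieDr IH1 IH2 raddfD mulrDr raddfD.
rewrite !linearZ /= lieZr -scalerAr linearZ /= alpha_tpow tinv_tpow -tpowD.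
by rewrite delta_tpow aa.
Qed.

Lemma delta_alpha b b' : [lie delta b, alpha b'] = 2 *: alpha ((b - tinv b) * b').
Proof.
elim/laurent_ind: b=> [|b1 b2 IH1 IH2|c m].
- by rewrite tinv0 subr0 mul0r !raddf0 lie0l.
- by rewrite !raddfD lieDl IH1 IH2 /= -scalerDr -raddfD; congr (_ *: alpha _); ring.
rewrite [tinv _]linearZ /= -scalerBr -scalerAl !linearZ /= lieZl delta_tpow.
congr (_ *: _).
elim/laurent_ind: b'=> [|b1 b2 IH1 IH2|c' m'].
- by rewrite mulr0 !raddf0 lie0r.
- by rewrite raddfD lieDr IH1 IH2 mulrDr raddfD scalerDr.
rewrite !linearZ /= lieZr -scalerAr linearZ /= alpha_tpow tinv_tpow mulrBl -!tpowD.
rewrite raddfB /= !alpha_tpow da ![m' + _]addrC; lin_eq F L.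
Qed.

Section Central.
Hypothesis d1 : d 1 = [lie a 1, a 0].
Variable g : nat -> L.
Hypothesis g0_0 : [lie a 0, [lie a 0, a 1]] = [lie a 0, g 0].
Hypothesis g0_1 : [lie [lie a 0, a 1], a 1] = [lie g 0, a 1].
Hypothesis gS_0 : forall k,
  [lie a 0, [lie a 0, [lie a 1, g k]]] = 4 *: [lie a 0, g k.+1].
Hypothesis gS_1 : forall k,
  [lie [lie [lie g k, a 0], a 1], a 1] = 4 *: [lie g k.+1, a 1].
Hypothesis gg : forall k l, [lie g k, g l] = 0.

(** Twice the scalar part of the generator with index k + 1. *)
Definition central (k : nat) : L := 2 *: g k - delta (gdiag F k).

Lemma delta_gdiag0 : delta (gdiag F 0) = - (2 *: d 1).
Proof.
rewrite /gdiag expr0 mul1r mulr_natl -mulrnBl raddfMn raddfB /= -tpow0.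
by rewrite !delta_tpow d0 subr0 d_opp -scaler_nat scalerN.
Qed.

(** By induction on k: once [2 *: g k] and [delta (gdiag F k)] have equal brackets
    with a_0 and a_1, the relations for [g k.+1] express its brackets with a_0 and
    a_1 through [delta (gdiag F k)], and there the result is known. *)
Lemma central_generators k : [lie a 0, central k] = 0 /\ [lie central k, a 1] = 0.
Proof.
elim: k => [|k [IH0 IH1]]; rewrite /central.
  rewrite !lieE delta_gdiag0 !lieE -g0_0 -g0_1 d1 [[lie a 1, a 0]]lieC !lieE.
  by split; lin_eq F L.
have E0 : 2 *: [lie g k, a 0] = [lie delta (gdiag F k), a 0].
  move: IH0; rewrite lieC /central !lieE => /eqP; rewrite oppr_eq0 subr_eq0.
  by move/eqP.
have E1 : 2 *: [lie a 1, g k] = [lie a 1, delta (gdiag F k)].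
  move: IH1; rewrite lieC /central !lieE => /eqP; rewrite oppr_eq0 subr_eq0.
  by move/eqP.
rewrite !lieE; split; apply: (@scale_natr_inj F L charF0 3).
  transitivity (2 *: (4 *: [lie a 0, g k.+1]) - [lie a 0, 4 *: delta (gdiag F k.+1)]).
    by rewrite !lieE; lin_eq F L.
  rewrite -gS_0 gdiagS -delta_tmean_left -E1 !lieE; lin_eq F L.
transitivity (2 *: (4 *: [lie g k.+1, a 1]) - [lie 4 *: delta (gdiag F k.+1), a 1]).
  by rewrite !lieE; lin_eq F L.
rewrite -gS_1 gdiagS -delta_tmean_right -E0 !lieE; lin_eq F L.
Qed.

Lemma aS m : 2 *: a (m + 2) = [lie d 1, a (m + 1)] + 2 *: a m.
Proof.
by rewrite da addrK -addrA; lin_eq F L.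
Qed.

Lemma centralizer_a x : [lie x, a 0] = 0 -> [lie x, a 1] = 0 ->
  forall m, [lie x, a m] = 0.
Proof.
move=> x0 x1; have xd1 : [lie x, d 1] = 0 by rewrite d1; exact: centralizer_bracket.
elim/two_sided_ind=> // m IH1 IH2; apply: scale2_inj; rewrite scaler0 -[LHS]lieZr.
  by rewrite aS !lieE centralizer_bracket // IH1 scaler0 addr0.
have -> : 2 *: a m = 2 *: a (m + 2) - [lie d 1, a (m + 1)].
  by rewrite aS; lin_eq F L.
by rewrite !lieE centralizer_bracket // IH2 scaler0 subr0.
Qed.

Lemma central_alpha k b : [lie central k, alpha b] = 0.
Proof.
have [c0 c1] := central_generators k.
apply: centralizer_lext; apply: centralizer_a => //.
by rewrite lieC c0 oppr0.
Qed.

Lemma central_delta k b : [lie central k, delta b] = 0.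
Proof.
apply: centralizer_lext => m; rewrite -[m]subr0 -aa.
by apply: centralizer_bracket; rewrite -alpha_tpow central_alpha.
Qed.

(** Write c_k for the central elements and g_k for the generators.  Diagonal
    Onsager elements commute with each other and with every c_k, hence
    [c_k, c_l] = [2 g_k, 2 g_l] = 0. *)
Lemma central_central k l : [lie central k, central l] = 0.
Proof.
have gE n : 2 *: g n = central n + delta (gdiag F n) by rewrite subrK.
transitivity ([lie 2 *: g k, 2 *: g l]); last by rewrite !lieE gg !scaler0.
have expand (x x' y y' : L) : [lie x, y'] = 0 -> [lie y, x'] = 0 -> [lie y, y'] = 0 ->
    [lie x + y, x' + y'] = [lie x, x'].
  by move=> e1 e2 e3; rewrite !lieE e1 e2 e3; lin_eq F L.
by rewrite !gE expand ?delta_delta ?central_delta // lieC central_delta oppr0.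
Qed.

End Central.

Section Inverse.
Variable c : nat -> L.
Hypothesis c_a : forall k m, [lie c k, a m] = 0.
Hypothesis c_c : forall k l, [lie c k, c l] = 0.
Variable kappa : int -> nat -> L.
Hypothesis kappa0 : kappa 0 = (fun=> 0).
Hypothesis kappa1 : kappa 1 = (fun k => 2^-1 *: c k).
Hypothesis kappaS : forall m k,
  kappa (m + 2) k = 2 *: kappa (m + 1) k.+1 - kappa m k + c k.

Lemma kappaP m k : kappa m k = 2 *: kappa (m + 1) k.+1 - kappa (m + 2) k + c k.
Proof. by rewrite kappaS; lin_eq F L. Qed.

Lemma kappa_comm x : (forall k, [lie x, c k] = 0) ->
  forall m k, [lie x, kappa m k] = 0.
Proof.
move=> xc; elim/two_sided_ind=> [||m IH1 IH2|m IH1 IH2] k.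
- by rewrite kappa0 lie0r.
- by rewrite kappa1 lieZr xc scaler0.
- by rewrite kappaS !lieDr lieNr lieZr xc IH1 IH2; lin_eq F L.
by rewrite kappaP !lieDr lieNr lieZr xc IH1 IH2; lin_eq F L.
Qed.

Lemma kappa_opp m k : kappa (- m) k = kappa m k.
Proof.
elim/two_sided_ind: m k => [||m IH1 IH2|m IH1 IH2] k.
- by rewrite oppr0.
- rewrite kappaP kappa1 kappa0; lin_eq F L.
- rewrite [LHS]kappaP [RHS]kappaS -IH1 -IH2; congr (2 *: kappa _ _ - kappa _ _ + _); lia.
rewrite (kappaP m) -IH1 -IH2.
rewrite (_ : - m = - (m + 2) + 2) ?kappaS; last by lia.
by congr (2 *: kappa _ _ - kappa _ _ + _); lia.
Qed.

Definition kappa_ext (k : nat) : laurent F -> L := lext (kappa^~ k).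
HB.instance Definition _ k := GRing.Linear.on (kappa_ext k).

Lemma kappa_ext_tpow k m : kappa_ext k (tpow F m) = kappa m k.
Proof. exact: lext_tpow. Qed.

Lemma kappa_ext_tinv k b : kappa_ext k (tinv b) = kappa_ext k b.
Proof.
elim/laurent_ind: b=> [|b b' IHb IHb'|e m].
- by rewrite tinv0.
- by rewrite !raddfD /= IHb IHb'.
by rewrite !linearZ /= tinv_tpow !kappa_ext_tpow kappa_opp.
Qed.

(** The error term vanishes on Laurent polynomials with value 0 at t = 1; on
    these, multiplication by f is the shift of k. *)
Lemma kappa_ext_tmean k b :
  kappa_ext k (tmean F * b) = kappa_ext k.+1 b + eval1 b *: (2^-1 *: c k).
Proof.
elim/laurent_ind: b=> [|b b' IHb IHb'|e m].
- by rewrite mulr0 !raddf0 scale0r addr0.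
- by rewrite mulrDr !raddfD /= IHb IHb' scalerDl; lin_eq F L.
rewrite -scalerAr !linearZ /= eval1_tpow tmean_tpow linearZ raddfD /=.
rewrite !kappa_ext_tpow (_ : m + 1 = m - 1 + 2); last by lia.
rewrite kappaS subrK; lin_eq F L.
Qed.

Lemma kappa_ext_gdiag n k : kappa_ext k (gdiag F n) = c (k + n).
Proof.
elim: n k => [|n IH] k; last first.
  by rewrite gdiagS kappa_ext_tmean eval1_gdiag scale0r addr0 IH addSnnS.
rewrite /gdiag expr0 mul1r mulr_natl -mulrnBl raddfMn raddfB /= -tpow0.
by rewrite !kappa_ext_tpow kappa_opp kappa0 kappa1 addn0 -scaler_nat; lin_eq F L.
Qed.

(** For a diagonal entry f, [kappa_ext 0 f] lifts the scalar matrix f + f(t^-1),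
    as f(1) = 0, and [delta f] lifts diag(f - f(t^-1)); these add up to twice
    diag(f). *)
Definition Oalg_lift (x : Oalg F) : L :=
  alpha (off_entry x)
    + 2^-1 *: (kappa_ext 0 (diag_entry x) + delta (diag_entry x)).

Fact Oalg_lift_linear : linear Oalg_lift.
Proof. by move=> e x y; rewrite /Oalg_lift !linearP /=; lin_eq F L. Qed.
HB.instance Definition _ := GRing.isLinear.Build F (Oalg F) L *:%R Oalg_lift
  Oalg_lift_linear.

Lemma kappa_ext_comm x k b : (forall k, [lie x, c k] = 0) ->
  [lie x, kappa_ext k b] = 0.
Proof.
by move=> xc; apply: centralizer_lext => m; exact: kappa_comm.
Qed.

(** The bracket of O only involves f - f(t^-1) for diagonal entries f, and the
    diagonal of [A(b), A(b')] is odd under t |-> t^-1, so that the symmetric part,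
    carried by kappa, drops out on both sides. *)
Lemma Oalg_lift_bracket : {morph Oalg_lift : x y / [lie x, y]}.
Proof.
move=> x y; rewrite /Oalg_lift diag_entry_bracket off_entry_bracket.
set b := off_entry x; set b' := off_entry y.
set u := diag_entry x; set u' := diag_entry y.
have c_alpha k v : [lie c k, alpha v] = 0 by exact: centralizer_lext.
have c_delta k v : [lie c k, delta v] = 0.
  by apply: centralizer_lext => m; rewrite -[m]subr0 -aa centralizer_bracket.
have kappa_central v k : [lie kappa_ext 0 v, c k] = 0.
  by rewrite lieC kappa_ext_comm ?oppr0.
have ak v w : [lie alpha v, kappa_ext 0 w] = 0.
  by apply: kappa_ext_comm => k; rewrite lieC c_alpha oppr0.
have dk v w : [lie delta v, kappa_ext 0 w] = 0.
  by apply: kappa_ext_comm => k; rewrite lieC c_delta oppr0.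
have kk v w : [lie kappa_ext 0 v, kappa_ext 0 w] = 0 by exact: kappa_ext_comm.
rewrite !lieE ak dk kk (lieC (kappa_ext 0 u) (alpha b')) ak.
rewrite (lieC (kappa_ext 0 u) (delta u')) dk delta_delta.
rewrite (lieC (alpha b) (delta u')) !delta_alpha alpha_alpha.
have -> : b' * tinv b = tinv (b * tinv b') by rewrite tinvM tinvK mulrC.
rewrite !raddfB /= kappa_ext_tinv.
have -> : delta (tinv (b * tinv b')) = - delta (b * tinv b').
  by rewrite delta_tinv.
by lin_eq F L.
Qed.

Lemma Oalg_lift_gen x : Oalg_lift (Oelt F x) =
  match x with
  | genW0 => a 0 | genW1 => a 1
  | genG k => 2^-1 *: (c k + delta (gdiag F k))
  end.
Proof.
case: x => [||k]; rewrite /Oalg_lift.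
- rewrite diag_entry_W0 off_entry_W0 !raddf0 -tpow0 alpha_tpow; lin_eq F L.
- rewrite diag_entry_W1 off_entry_W1 !raddf0 alpha_tpow; lin_eq F L.
rewrite diag_entry_G off_entry_G raddf0 kappa_ext_gdiag add0n; lin_eq F L.
Qed.

Section Retraction.
Variable phi : {linear L -> Oalg F}.
Hypothesis phiM : {morph phi : x y / [lie x, y]}.
Hypothesis d1 : d 1 = [lie a 1, a 0].
Hypothesis phi_a0 : phi (a 0) = Oelt F genW0.
Hypothesis phi_a1 : phi (a 1) = Oelt F genW1.
Hypothesis phi_c : forall k, phi (c k) = 2 *: Oelt F (genG k) - phi (delta (gdiag F k)).
Local Notation t := (tpow F 1).
Local Notation tV := (tpow F (- 1)).

Let scale2 (b : laurent F) : 2 *: b = 2 * b.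
Proof. by rewrite scaler_nat mulr_natl. Qed.

Lemma entries_phi_a m : entries (phi (a m)) = (0, tpow F m).
Proof.
have phi_d1 : entries (phi (d 1)) = (t - tV, 0).
  rewrite d1 phiM phi_a0 phi_a1 entries_bracket.
  rewrite /entries diag_entry_W0 diag_entry_W1 off_entry_W0 off_entry_W1.
  by rewrite /entry_bracket /= tinv0 tinv1 tinv_tpow; congr (_, _); ring.
have phi_d1_a k : entries (phi (a k)) = (0, tpow F k) ->
    entries (phi [lie d 1, a k]) = (0, 2 *: (tpow F (k + 1) - tpow F (k - 1))).
  move=> ak; rewrite phiM entries_bracket ak phi_d1 /entry_bracket /= !tinvE.
  by rewrite !tpowD scale2; congr (_, _); ring.
have phi_comb x y e : entries (phi (x + e *: y)) =
    ((entries (phi x)).1 + e *: (entries (phi y)).1,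
     (entries (phi x)).2 + e *: (entries (phi y)).2).
  by rewrite linearD linearZ /entries /= !linearD !linearZ.
elim/two_sided_ind: m => [||m IH1 IH2|m IH1 IH2].
- by rewrite phi_a0 /entries diag_entry_W0 off_entry_W0.
- by rewrite phi_a1 /entries diag_entry_W1 off_entry_W1.
- have -> : a (m + 2) = a m + 2^-1 *: [lie d 1, a (m + 1)].
    by apply: scale2_inj; rewrite /= aS; lin_eq F L.
  rewrite phi_comb IH1 (phi_d1_a _ IH2) /= -addrA addrK.
  congr (_, _); lin_eq F (laurent F).
have -> : a m = a (m + 2) + - 2^-1 *: [lie d 1, a (m + 1)].
  by apply: scale2_inj; rewrite /= scalerDr aS; lin_eq F L.
rewrite phi_comb IH2 (phi_d1_a _ IH1) /= -addrA addrK.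
congr (_, _); lin_eq F (laurent F).
Qed.

Lemma diag_phi_alpha b : diag_entry (phi (alpha b)) = 0.
Proof.
elim/laurent_ind: b=> [|v1 v2 IH1 IH2|e m].
- by rewrite !raddf0.
- by rewrite !raddfD /= IH1 IH2 addr0.
rewrite !linearZ /= alpha_tpow.
by rewrite (congr1 fst (entries_phi_a m) : diag_entry _ = _) scaler0.
Qed.

Lemma off_phi_alpha b : off_entry (phi (alpha b)) = b.
Proof.
elim/laurent_ind: b=> [|v1 v2 IH1 IH2|e m].
- by rewrite !raddf0.
- by rewrite !raddfD /= IH1 IH2.
rewrite !linearZ /= alpha_tpow.
by rewrite (congr1 snd (entries_phi_a m) : off_entry _ = _).
Qed.

Lemma entries_phi_d m : entries (phi (d m)) = (tpow F m - tpow F (- m), 0).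
Proof.
rewrite -{1}[m]subr0 -aa phiM entries_bracket !entries_phi_a /entry_bracket /=.
by rewrite !tinv_tpow oppr0 tpow0; congr (_, _); ring.
Qed.

Lemma diag_phi_delta b : diag_entry (phi (delta b)) = b - tinv b.
Proof.
elim/laurent_ind: b=> [|v1 v2 IH1 IH2|e m].
- by rewrite tinv0 subr0 !raddf0.
- by rewrite !raddfD /= IH1 IH2; lin_eq F (laurent F).
rewrite [tinv _]linearZ /= -scalerBr !linearZ /= delta_tpow tinv_tpow.
by rewrite (congr1 fst (entries_phi_d m) : diag_entry _ = _).
Qed.

Lemma off_phi_delta b : off_entry (phi (delta b)) = 0.
Proof.
elim/laurent_ind: b=> [|v1 v2 IH1 IH2|e m].
- by rewrite !raddf0.
- by rewrite !raddfD /= IH1 IH2 addr0.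
rewrite !linearZ /= delta_tpow.
by rewrite (congr1 snd (entries_phi_d m) : off_entry _ = _) scaler0.
Qed.

Lemma diag_phi_c k : diag_entry (phi (c k)) = 2 *: (tmean F ^+ k * (t + tV - 2)).
Proof.
rewrite phi_c raddfB /= linearZ /= diag_entry_G diag_phi_delta /gdiag.
rewrite tinvM rmorphXn /= tinv_tmean tinvB tinvM rmorph_nat tinv_tpow opprK.
rewrite !scale2; ring.
Qed.

Lemma off_phi_c k : off_entry (phi (c k)) = 0.
Proof.
by rewrite phi_c raddfB /= linearZ /= off_entry_G off_phi_delta scaler0 subr0.
Qed.

Let linear_step (V W : lmodType F) (f : {linear V -> W}) x y z :
  f (2 *: x - y + z) = 2 *: f x - f y + f z.
Proof. by rewrite linearD linearB linearZ. Qed.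

Let tmean2 k : 2 * tmean F ^+ k.+1 = (t + tV) * tmean F ^+ k.
Proof.
by rewrite exprS mulrA -scale2 /tmean scalerA divff // scale1r.
Qed.

Lemma off_phi_kappa m k : off_entry (phi (kappa m k)) = 0.
Proof.
elim/two_sided_ind: m k => [||m IH1 IH2|m IH1 IH2] k.
- by rewrite kappa0 !raddf0.
- by rewrite kappa1 !linearZ /= off_phi_c scaler0.
- rewrite kappaS 2!linear_step /= IH1 IH2 off_phi_c; lin_eq F (laurent F).
rewrite kappaP 2!linear_step /= IH1 IH2 off_phi_c; lin_eq F (laurent F).
Qed.

Lemma diag_phi_kappa m k :
  diag_entry (phi (kappa m k)) = tmean F ^+ k * (tpow F m + tpow F (- m) - 2).
Proof.
have ttV := tpowVK F 1.
have mm1 n : - (n + 1) = - n + - 1 :> int by lia.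
have mm2 n : - (n + 2) = - n + - 1 + - 1 :> int by lia.
have pp2 n : n + 2 = n + 1 + 1 :> int by lia.
elim/two_sided_ind: m k => [||m IH1 IH2|m IH1 IH2] k.
- by rewrite kappa0 !raddf0 !tpow0; ring.
- by rewrite kappa1 !linearZ /= diag_phi_c scalerA mulVf // scale1r.
- rewrite kappaS 2!linear_step /= IH1 IH2 diag_phi_c !scale2 mulrA tmean2.
  rewrite mm1 mm2 pp2 !tpowD; ring: ttV.
rewrite kappaP 2!linear_step /= IH1 IH2 diag_phi_c !scale2 mulrA tmean2.
rewrite mm1 mm2 pp2 !tpowD; ring: ttV.
Qed.

Lemma diag_phi_kappa_ext b :
  diag_entry (phi (kappa_ext 0 b)) = b + tinv b - 2 *: (eval1 b *: 1).
Proof.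
elim/laurent_ind: b=> [|v1 v2 IH1 IH2|e m].
- by rewrite tinv0 !raddf0 scale0r scaler0 subr0 addr0.
- by rewrite !raddfD /= IH1 IH2; lin_eq F (laurent F).
rewrite !linearZ /= kappa_ext_tpow eval1_tpow tinv_tpow.
rewrite diag_phi_kappa expr0 mul1r -[X in _ - X](mulr1 2) -scale2.
lin_eq F (laurent F).
Qed.

Lemma off_phi_kappa_ext b : off_entry (phi (kappa_ext 0 b)) = 0.
Proof.
elim/laurent_ind: b=> [|v1 v2 IH1 IH2|e m].
- by rewrite !raddf0.
- by rewrite !raddfD /= IH1 IH2 addr0.
by rewrite !linearZ /= kappa_ext_tpow off_phi_kappa scaler0.
Qed.

(** On the diagonal, phi returns f + f(t^-1) - 2 f(1) from the kappa part and
    f - f(t^-1) from the Onsager part; since f(1) = 0 on O, half their sum is f. *)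
Lemma Oalg_liftK : cancel Oalg_lift phi.
Proof.
move=> x; rewrite /Oalg_lift; set b := off_entry x; set u := diag_entry x.
have -> : phi (alpha b + 2^-1 *: (kappa_ext 0 u + delta u)) =
    phi (alpha b) + 2^-1 *: (phi (kappa_ext 0 u) + phi (delta u)).
  by rewrite linearD linearZ /= linearD.
apply: Oalg_eq; rewrite linearD linearZ /= linearD /=.
  rewrite diag_phi_alpha diag_phi_delta diag_phi_kappa_ext.
  by rewrite eval1_diag_entry //; lin_eq F (laurent F).
by rewrite off_phi_alpha off_phi_delta off_phi_kappa_ext addr0 scaler0 addr0.
Qed.

End Retraction.
End Inverse.
End OnsagerSequences.

(** * The presentation *)

Section PresentedAlgebra.
Context (F : fieldType) (X : Type) (r : lie_term F X -> lie_term F X -> Prop).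

Lemma lie_eval_gen s : lie_eval (lie_gen r) s = lie_class r s.
Proof.
elim: s => [x||s IHs t IHt|c s IHs|s IHs t IHt] //=.
- by rewrite IHs IHt lie_classD.
- by rewrite IHs lie_classZ.
by rewrite IHs IHt lie_class_bracket.
Qed.

Lemma lie_pres_rel s t : r s t -> lie_eval (lie_gen r) s = lie_eval (lie_gen r) t.
Proof. by rewrite !lie_eval_gen => rst; apply/lie_classP/lc_rel. Qed.

Lemma lie_pres_endo_id (f : {linear lie_pres r -> lie_pres r}) :
  {morph f : x y / [lie x, y]} -> (forall x, f (lie_gen r x) = lie_gen r x) ->
  f =1 id.
Proof.
move=> fM f_gen x.
have [e [_ _ e_unique]] := lie_pres_universal lie_pres_rel.
by rewrite (e_unique f) // -(e_unique (@idfun (lie_pres r))).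
Qed.

End PresentedAlgebra.

Theorem lemma4p23 (F : fieldType) (charF0 : [pchar F] =i pred0) :
  exists phi : {linear lie_pres (@Orel F) -> Oalg F},
    [/\ {morph phi : x y / lie_bracket x y},
        forall x : Ogen, phi (lie_gen (@Orel F) x) = Oelt F x
      & bijective phi].
Proof.
have n2 : (2 : F) != 0 := natr_neq0_char0 charF0 1.
have Oelt_rel s t : Orel s t -> lie_eval (@Oelt F) s = lie_eval (@Oelt F) t.
  apply: Orel_entries => // [||k].
  - by rewrite /entries diag_entry_W0 off_entry_W0.
  - by rewrite /entries diag_entry_W1 off_entry_W1.
  by rewrite /entries diag_entry_G off_entry_G.
have [phi [phiM phi_gen _]] := lie_pres_universal Oelt_rel.
exists phi; split=> //.
pose w := lie_gen (@Orel F).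
have wrel s t : Orel s t -> lie_eval w s = lie_eval w t := @lie_pres_rel _ _ _ s t.
have [a [d [a0 a1 d1 aa da]]] :=
  dolan_grady_onsager charF0 (wrel _ _ (Orel_W0W1 F)) (wrel _ _ (Orel_W1W0 F)).
pose g k := w (genG k).
have g0_0 : [lie a 0, [lie a 0, a 1]] = [lie a 0, g 0].
  by rewrite a0 a1; exact: wrel (Orel_W0G1 F).
have g0_1 : [lie [lie a 0, a 1], a 1] = [lie g 0, a 1].
  by rewrite a0 a1; exact: wrel (Orel_G1W1 F).
have gS_0 k : [lie a 0, [lie a 0, [lie a 1, g k]]] = 4 *: [lie a 0, g k.+1].
  by rewrite a0 a1; exact: wrel (@Orel_W0G F k.+1 isT).
have gS_1 k : [lie [lie [lie g k, a 0], a 1], a 1] = 4 *: [lie g k.+1, a 1].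
  by rewrite a0 a1; exact: wrel (@Orel_GW1 F k.+1 isT).
have gg k l : [lie g k, g l] = 0 := wrel _ _ (@Orel_GG F k l).
have d1a : d 1 = [lie a 1, a 0] by rewrite a0 a1.
pose z := central d g.
have z_a k m : [lie z k, a m] = 0.
  rewrite -(alpha_tpow a) /z.
  exact: (central_alpha charF0 aa da d1a g0_0 g0_1 gS_0 gS_1).
have z_z k l : [lie z k, z l] = 0.
  exact: (central_central charF0 aa da d1a g0_0 g0_1 gS_0 gS_1 gg).
have gE k : z k + delta d (gdiag F k) = 2 *: g k by rewrite /z /central subrK.
have [kappa [kappa0 kappa1 kappaS]] := kappa_exists z.
pose psi : {linear Oalg F -> lie_pres (@Orel F)} := Oalg_lift a d kappa.
have psiM : {morph psi : x y / [lie x, y]}.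
  exact: (Oalg_lift_bracket charF0 aa da z_a z_z kappa0 kappa1 kappaS).
have psi_gen x : psi (Oelt F x) = w x.
  rewrite [LHS](Oalg_lift_gen charF0 a d kappa0 kappa1 kappaS x).
  by case: x => // k; rewrite gE scalerA mulVf // scale1r.
have phi_z k : phi (z k) = 2 *: Oelt F (genG k) - phi (delta d (gdiag F k)).
  rewrite -phi_gen -linearZ -linearB /=.
  by rewrite -[in LHS](addrK (delta d (gdiag F k)) (z k)) gE.
exists psi; last first.
  apply: (Oalg_liftK charF0 aa da kappa0 kappa1 kappaS phiM d1a _ _ phi_z).
    by rewrite a0 phi_gen.
  by rewrite a1 phi_gen.
pose f : {linear lie_pres (@Orel F) -> lie_pres (@Orel F)} := psi \o phi.
apply: (@lie_pres_endo_id _ _ _ f) => [x y|x] /=.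
  by rewrite phiM psiM.
by rewrite phi_gen psi_gen.
Qed.
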